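(* Write $\tau=\frac{1+i\sqrt3}{2}$. The group $\Gamma_3$ is generated by the classes of $$a=\begin{pmatrix}1&0&0\\0&\tau&0\\0&0&1\end{pmatrix},\qquad b=\begin{pmatrix}-\bar\tau&-1&\tau+2\\1&1&-2\tau+1\\1&0&-2\tau+1\end{pmatrix},$$ and has a presentation with generators $a,b$ and defining relations $$a^6=b^4=e^2=f^2=g^6=h^3=1,\quad \mathrm{br}_2(a,e),\quad \mathrm{br}_4(f,g),\quad (ab)^3=1,$$ where $e=ba^{-1}b^{-1}a^{-2}b^2a^2bab^{-1}$, $f=ab^{-2}a^{-1}$, $g=b^2a^{-1}b^2$, $h=a^{-1}b^2a^2bab^{-1}$.
   Context: $J=\begin{pmatrix}0&0&1\\0&1&0\\1&0&0\end{pmatrix}$, $U(J)=\{A\in GL_3(\mathbb{C}):A^*JA=J\}$, and $\Gamma_3=PU(J,\mathcal{O}_3)$ is the image in $PU(J)$ of $U(J)\cap GL_3(\mathcal{O}_3)$, where $\mathcal{O}_3=\mathbb{Z}[\tau]$. $\mathrm{br}_n(x,y)$ denotes the braid relation of length $n$: $xyx\cdots=yxy\cdots$ with $n$ factors on each side. *)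

(* Defs.v *)
From HB Require Import structures.
From mathcomp Require Import all_boot all_order all_algebra.
From mathcomp Require Import boolp reals.
From mathcomp Require Import complex ring.

Set Implicit Arguments.
Unset Strict Implicit.
Unset Printing Implicit Defensive.

Import GRing.Theory Num.Theory.

Local Open Scope group_scope.
Local Open Scope quotient_scope.

(* A group is a [groupType]; a subgroup is a predicate. *)

Definition generates (G : groupType) (S : seq G) : Prop :=
  forall H : {pred G}, group_closed H -> {subset S <= H} -> forall x, x \in H.

HB.mixin Record isConjClosed (G : groupType) (N : {pred G}) := {
  gpredJl : {in N, forall x y, x ^ y \in N}
}.

#[short(type="normalClosed")]
HB.structure Definition NormalClosed (G : groupType) :=
  {N of isConjClosed G N & GroupClosed G N}.

Section QuotientGroup.
Variables (G : groupType) (N : normalClosed G).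

Definition coset_rel : rel G := [rel x y | x^-1 * y \in N].

Lemma coset_rel_equiv : equiv_class_of coset_rel.
Proof.
split=> [x|x y|y x z]; rewrite /coset_rel /=; first by rewrite mulVg gpred1.
  by rewrite -gpredV invgM invgK.
by move=> xy yz; rewrite -(mulVKg y z) mulgA gpredM.
Qed.

Canonical coset_equiv := EquivRelPack coset_rel_equiv.

Definition quotg := {eq_quot coset_rel}.
HB.instance Definition _ := Choice.on quotg.
HB.instance Definition _ := EqQuotient.on quotg.

Definition cosetg (x : G) : quotg := \pi x.

Lemma cosetgP x y : cosetg x = cosetg y <-> x^-1 * y \in N.
Proof. by split=> [/eqmodP | h]; [|apply/eqmodP]. Qed.

Lemma cosetgK (u : quotg) : cosetg (repr u) = u.
Proof. exact: reprK. Qed.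

Definition quotg_one := cosetg 1.
Definition quotg_mul (u v : quotg) := cosetg (repr u * repr v).
Definition quotg_inv (u : quotg) := cosetg (repr u)^-1.

Lemma quotg_mulE x y : quotg_mul (cosetg x) (cosetg y) = cosetg (x * y).
Proof.
apply/cosetgP; set x' := repr _; set y' := repr _.
have /cosetgP hx : cosetg x' = cosetg x by exact: cosetgK.
have /cosetgP hy : cosetg y' = cosetg y by exact: cosetgK.
have -> : (x' * y')^-1 * (x * y) = (x'^-1 * x) ^ y' * (y'^-1 * y).
  by rewrite /conjg invgM !mulgA mulgK.
by rewrite gpredM // gpredJl.
Qed.

Lemma quotg_invE x : quotg_inv (cosetg x) = cosetg x^-1.
Proof.
apply/cosetgP; set x' := repr _.
have /cosetgP hx : cosetg x = cosetg x' by rewrite cosetgK.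
have -> : x'^-1^-1 * x^-1 = (x^-1 * x') ^ x^-1.
  by rewrite /conjg !invgK !mulgA mulgV mul1g.
exact: gpredJl.
Qed.

Lemma quotg_mulA : associative quotg_mul.
Proof.
move=> u v w; rewrite -(cosetgK u) -(cosetgK v) -(cosetgK w).
by rewrite !quotg_mulE mulgA.
Qed.

Lemma quotg_mul1 : left_id quotg_one quotg_mul.
Proof. by move=> u; rewrite -(cosetgK u) quotg_mulE mul1g. Qed.

Lemma quotg_1mul : right_id quotg_one quotg_mul.
Proof. by move=> u; rewrite -(cosetgK u) quotg_mulE mulg1. Qed.

Lemma quotg_mulV : left_inverse quotg_one quotg_inv quotg_mul.
Proof. by move=> u; rewrite -(cosetgK u) quotg_invE quotg_mulE mulVg. Qed.

Lemma quotg_Vmul : right_inverse quotg_one quotg_inv quotg_mul.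
Proof. by move=> u; rewrite -(cosetgK u) quotg_invE quotg_mulE mulgV. Qed.

HB.instance Definition _ := isGroup.Build quotg quotg_mulA quotg_mul1
  quotg_1mul quotg_mulV quotg_Vmul.

Lemma cosetgM x y : cosetg (x * y) = cosetg x * cosetg y.
Proof. by rewrite -quotg_mulE. Qed.

Lemma cosetgV x : cosetg x^-1 = (cosetg x)^-1.
Proof. by rewrite -quotg_invE. Qed.

End QuotientGroup.

Section NormalClosure.
Variables (G : groupType) (S : seq G).

Definition normal_closure : {pred G} :=
  fun x => `[< forall N : normalClosed G, {subset S <= N} -> x \in N >].

Lemma normal_closureP x : reflect
  (forall N : normalClosed G, {subset S <= N} -> x \in N) (x \in normal_closure).
Proof. exact: asboolP. Qed.

Fact normal_closureM : mulg_closed normal_closure.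
Proof.
move=> x y /normal_closureP hx /normal_closureP hy.
by apply/normal_closureP => N hN; rewrite gpredM ?hx ?hy.
Qed.

Fact normal_closure1 : 1 \in normal_closure.
Proof. by apply/normal_closureP => N _; exact: gpred1. Qed.

Fact normal_closureV : invg_closed normal_closure.
Proof.
move=> x /normal_closureP hx.
by apply/normal_closureP => N hN; rewrite gpredV hx.
Qed.

Fact normal_closureJ : {in normal_closure, forall x y, x ^ y \in normal_closure}.
Proof.
move=> x /normal_closureP hx y.
by apply/normal_closureP => N hN; apply: gpredJl; exact: hx.
Qed.

HB.instance Definition _ := isMulClosed.Build G normal_closure normal_closureM.
HB.instance Definition _ := isMul1Closed.Build G normal_closure normal_closure1.
HB.instance Definition _ := isInvClosed.Build G normal_closure normal_closureV.
HB.instance Definition _ := isConjClosed.Build G normal_closure normal_closureJ.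

End NormalClosure.

(* The free group on X: reduced words in the letters x (coded [(x, true)]) and *)
(* x^-1 (coded [(x, false)]), multiplied by concatenation and reduction.       *)
Section FreeGroup.
Variable X : choiceType.

Definition letter_inv (l : X * bool) := (l.1, ~~ l.2).

Definition reduced (w : seq (X * bool)) : bool :=
  sorted [rel l m | m != letter_inv l] w.

Definition push (l : X * bool) (w : seq (X * bool)) :=
  if w is m :: w' then if m == letter_inv l then w' else l :: w else [:: l].

Definition wmul (u v : seq (X * bool)) := foldr push v u.
Definition winv (u : seq (X * bool)) := rev (map letter_inv u).

Lemma letter_invK : involutive letter_inv.
Proof. by case=> x b; rewrite /letter_inv /= negbK. Qed.

Lemma push_reduced l w : reduced w -> reduced (push l w).
Proof.
case: w => //= m w; case: eqP => [_|/eqP h] pw; first exact: path_sorted pw.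
by rewrite /reduced /= h.
Qed.

Lemma pushK l w : reduced w -> push l (push (letter_inv l) w) = w.
Proof.
case: w => [|m w] /=; first by rewrite eqxx.
rewrite letter_invK; case: eqP => [->|/eqP nml] pw /=; last by rewrite eqxx.
by case: w pw => //= m' w /andP[/negPf ->].
Qed.

Lemma push_Kl l w : reduced w -> push (letter_inv l) (push l w) = w.
Proof. by move=> rw; rewrite -{2}(letter_invK l) pushK. Qed.

Lemma wmul_reduced u v : reduced v -> reduced (wmul u v).
Proof. by move=> rv; elim: u => //= l u; exact: push_reduced. Qed.

Lemma wmul_push l u v : reduced v -> wmul (push l u) v = push l (wmul u v).
Proof.
move=> rv; case: u => //= m u; case: eqP => [->|] //=.
by rewrite pushK // wmul_reduced.
Qed.

Lemma wmulA u v w : reduced w -> wmul u (wmul v w) = wmul (wmul u v) w.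
Proof. by move=> rw; elim: u => //= l u IH; rewrite wmul_push // IH. Qed.

Lemma wmul0 u : reduced u -> wmul u [::] = u.
Proof.
elim: u => //= l u IH ru; rewrite IH; last exact: path_sorted ru.
by case: u ru {IH} => //= m u /andP[/negPf ->].
Qed.

Lemma wmul_catl u v w : wmul (u ++ v) w = wmul u (wmul v w).
Proof. exact: foldr_cat. Qed.

Lemma winv_reduced u : reduced u -> reduced (winv u).
Proof.
rewrite /reduced /winv rev_sorted sorted_map; apply: sub_sorted => l m /=.
by apply: contra => /eqP ->; rewrite letter_invK eqxx.
Qed.

Lemma wmulV u v : reduced v -> wmul (winv u) (wmul u v) = v.
Proof.
move=> rv; elim: u => //= l u IH; rewrite /winv map_cons rev_cons -cats1.
by rewrite wmul_catl /= push_Kl ?wmul_reduced.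
Qed.

Lemma winvK : involutive winv.
Proof. by move=> u; rewrite /winv map_rev revK (mapK letter_invK). Qed.

Definition freeg := {w : seq (X * bool) | reduced w}.
HB.instance Definition _ := Choice.on freeg.

Definition freeg_one : freeg := exist _ [::] isT.
Definition freeg_mul (u v : freeg) : freeg :=
  exist _ (wmul (val u) (val v)) (wmul_reduced (val u) (valP v)).
Definition freeg_inv (u : freeg) : freeg :=
  exist _ (winv (val u)) (winv_reduced (valP u)).

Lemma freeg_mulA : associative freeg_mul.
Proof. by move=> u v w; apply: val_inj; rewrite /= wmulA //; exact: valP. Qed.

Lemma freeg_mul1 : left_id freeg_one freeg_mul.
Proof. by move=> u; apply: val_inj. Qed.

Lemma freeg_1mul : right_id freeg_one freeg_mul.
Proof. by move=> u; apply: val_inj; rewrite /= wmul0 //; exact: valP. Qed.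

Lemma freeg_mulV : left_inverse freeg_one freeg_inv freeg_mul.
Proof.
move=> u; apply: val_inj; rewrite /= -{2}(wmul0 (valP u)).
exact: (@wmulV _ [::]).
Qed.

Lemma freeg_Vmul : right_inverse freeg_one freeg_inv freeg_mul.
Proof.
move=> u; apply: val_inj; rewrite /= -{1}(winvK (val u)).
rewrite -{2}(wmul0 (winv_reduced (valP u))); exact: (@wmulV _ [::]).
Qed.

HB.instance Definition _ := isGroup.Build freeg freeg_mulA freeg_mul1
  freeg_1mul freeg_mulV freeg_Vmul.

Definition fgen (x : X) : freeg := exist _ [:: (x, true)] isT.

End FreeGroup.

(* A pair (u, v) in rels stands for the relation u = v. *)
Definition presented (X : choiceType) (rels : seq (freeg X * freeg X)) :=
  quotg (normal_closure [seq r.1 / r.2 | r <- rels]).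

HB.instance Definition _ X rels := Group.on (@presented X rels).

Definition has_presentation (G : groupType) (X : choiceType) (g : X -> G)
    (rels : seq (freeg X * freeg X)) : Prop :=
  exists phi : {multiplicative presented rels -> G},
    bijective phi /\ forall x, phi (cosetg _ (fgen x)) = g x.

Fixpoint altprod (G : groupType) n (x y : G) : G :=
  if n is m.+1 then x * altprod m y x else 1.

Definition br (G : groupType) n (x y : G) : G * G :=
  (altprod n x y, altprod n y x).

Local Close Scope group_scope.
Local Open Scope ring_scope.

Section GeneralLinear.
Variables (n : nat) (C : comUnitRingType).

Record GL := MkGL { glval :> 'M[C]_n; glvalP : glval \in unitmx }.

HB.instance Definition _ := [isSub for glval].
HB.instance Definition _ := [Choice of GL by <:].

Fact gl_mul_subproof (A B : GL) : A *m B \in unitmx.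
Proof. by rewrite unitmx_mul !glvalP. Qed.
Fact gl_inv_subproof (A : GL) : invmx A \in unitmx.
Proof. by rewrite unitmx_inv glvalP. Qed.

Definition gl_one := MkGL (@unitmx1 C n).
Definition gl_mul A B := MkGL (gl_mul_subproof A B).
Definition gl_inv A := MkGL (gl_inv_subproof A).

Lemma gl_mulA : associative gl_mul.
Proof. by move=> A B D; apply: val_inj; rewrite /= mulmxA. Qed.
Lemma gl_mul1 : left_id gl_one gl_mul.
Proof. by move=> A; apply: val_inj; rewrite /= mul1mx. Qed.
Lemma gl_1mul : right_id gl_one gl_mul.
Proof. by move=> A; apply: val_inj; rewrite /= mulmx1. Qed.
Lemma gl_mulV : left_inverse gl_one gl_inv gl_mul.
Proof. by move=> A; apply: val_inj; rewrite /= mulVmx ?glvalP. Qed.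
Lemma gl_Vmul : right_inverse gl_one gl_inv gl_mul.
Proof. by move=> A; apply: val_inj; rewrite /= mulmxV ?glvalP. Qed.

HB.instance Definition _ := isGroup.Build GL gl_mulA gl_mul1
  gl_1mul gl_mulV gl_Vmul.

End GeneralLinear.

Definition mx3 (C : pzRingType) (rows : seq (seq C)) : 'M[C]_3 :=
  \matrix_(i < 3, j < 3) nth 0 (nth [::] rows i) j.

Section Gamma3.
Variable C : numClosedFieldType.

Definition ctmx n (A : 'M[C]_n) : 'M[C]_n := map_mx Num.conj A^T.

Lemma ctmxM n (A B : 'M[C]_n) : ctmx (A *m B) = ctmx B *m ctmx A.
Proof. by rewrite /ctmx trmx_mul map_mxM. Qed.

Definition Jmx : 'M[C]_3 := mx3 [:: [:: 0; 0; 1]; [:: 0; 1; 0]; [:: 1; 0; 0]].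

Definition preservesJ : {pred GL 3 C} := fun A => ctmx A *m Jmx *m A == Jmx.

Fact preservesJ_group : group_closed preservesJ.
Proof.
split=> [|A B]; rewrite !unfold_in /=.
  by rewrite /ctmx trmx1 map_mx1 mul1mx mulmx1.
move=> /eqP hA /eqP hB; rewrite ctmxM.
have {}hB : ctmx (invmx B) *m Jmx *m invmx B = Jmx.
  rewrite -{1}hB !mulmxA -ctmxM mulmxV ?glvalP //.
  by rewrite /ctmx trmx1 map_mx1 mul1mx -mulmxA mulmxV ?glvalP // mulmx1.
by rewrite -!mulmxA (mulmxA _ Jmx) (mulmxA _ A) hA mulmxA hB.
Qed.

Definition UJ := {A : GL 3 C | preservesJ A}.
HB.instance Definition _ := SubChoice.on UJ.
HB.instance Definition _ :=
  SubChoice_isSubGroup.Build (GL 3 C) preservesJ UJ preservesJ_group.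

Definition scalarUJ : {pred UJ} := fun A => is_scalar_mx (val (val A)).

Fact scalarUJ_group : group_closed scalarUJ.
Proof.
split=> [|A B]; rewrite !unfold_in /=; first exact: scalar_mx_is_scalar.
move=> /is_scalar_mxP[x hA] /is_scalar_mxP[y hB].
by rewrite hA hB invmx_scalar -scalar_mxM scalar_mx_is_scalar.
Qed.

Fact scalarUJ_conj : {in scalarUJ, forall A B, (A ^ B)%g \in scalarUJ}.
Proof.
move=> A; rewrite unfold_in => /is_scalar_mxP[x hA] B; rewrite unfold_in /=.
rewrite hA -scalar_mxC mulmxA mulVmx ?glvalP // mul1mx.
exact: scalar_mx_is_scalar.
Qed.

HB.instance Definition _ :=
  isMulClosed.Build UJ scalarUJ (group_closedM scalarUJ_group).
HB.instance Definition _ := isMul1Closed.Build UJ scalarUJ scalarUJ_group.1.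
HB.instance Definition _ :=
  isInvClosed.Build UJ scalarUJ (group_closedV scalarUJ_group).
HB.instance Definition _ := isConjClosed.Build UJ scalarUJ scalarUJ_conj.

(* The centre of U(J) consists of its scalar matrices. *)
Definition PUJ := quotg scalarUJ.
HB.instance Definition _ := Group.on PUJ.

Definition tau : C := (1 + 'i * sqrtC 3) / 2.

Definition O3 : {pred C} :=
  fun z => `[< exists p : {poly int}, z = (map_poly intr p).[tau] >].

Definition GLO3 : {pred GL 3 C} :=
  fun A => (glval A \is a mxOver O3) && (glval A^-1%g \is a mxOver O3).

Definition inGamma3 : {pred PUJ} :=
  fun u => `[< exists A : UJ, val A \in GLO3 /\ u = cosetg _ A >].

Lemma O3P z :
  reflect (exists p : {poly int}, z = (map_poly intr p).[tau]) (z \in O3).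
Proof. exact: asboolP. Qed.

Lemma O3_subring : subring_closed O3.
Proof.
split=> [|x y /O3P[p ->] /O3P[q ->]|x y /O3P[p ->] /O3P[q ->]]; apply/O3P.
- by exists 1; rewrite rmorph1 hornerC.
- by exists (p - q); rewrite rmorphB hornerD hornerN.
- by exists (p * q); rewrite rmorphM hornerM.
Qed.

HB.instance Definition _ := GRing.isSubringClosed.Build C O3 O3_subring.

Lemma GLO3_group : group_closed GLO3.
Proof.
split=> [|A B]; rewrite !unfold_in.
  by rewrite invg1 andbb; apply: mxOver_scalar; rewrite ?rpred0 ?rpred1.
move=> /andP[hA hA'] /andP[hB hB']; rewrite invgF.
by apply/andP; split; apply: mxOverM.
Qed.

Lemma inGamma3_group : group_closed inGamma3.
Proof.
split=> [|u v]; rewrite !unfold_in.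
  by apply/asboolP; exists 1%g; split; first exact: GLO3_group.1.
move=> /asboolP[A [hA ->]] /asboolP[B [hB ->]]; apply/asboolP.
exists (A / B)%g; split; first by rewrite gmulfF GLO3_group.2.
by rewrite cosetgM cosetgV.
Qed.

Definition Gamma3 := {u : PUJ | inGamma3 u}.
HB.instance Definition _ := SubChoice.on Gamma3.
HB.instance Definition _ :=
  SubChoice_isSubGroup.Build PUJ inGamma3 Gamma3 inGamma3_group.

Definition amx : 'M[C]_3 :=
  mx3 [:: [:: 1; 0; 0]; [:: 0; tau; 0]; [:: 0; 0; 1]].

Definition bmx : 'M[C]_3 :=
  mx3 [:: [:: - tau^*; -1; tau + 2];
          [:: 1; 1; - 2 * tau + 1];
          [:: 1; 0; - 2 * tau + 1]].

Lemma tau2 : tau * tau = tau - 1.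
Proof.
have h3 : sqrtC 3 * sqrtC 3 = 3 :> C by rewrite -expr2 sqrtCK.
have hi : 'i * 'i = -1 :> C by exact: mulCii.
by rewrite /tau; field: h3 hi.
Qed.

Lemma conj_tau : tau^* = 1 - tau.
Proof.
rewrite /tau rmorphM fmorphV rmorphD rmorphM /= conjCi rmorph1 rmorph_nat.
have /CrealP -> : sqrtC 3 \is @Num.real C.
  by rewrite realE sqrtC_ge0 ler0n.
by field.
Qed.

Lemma tau_O3 : tau \in O3.
Proof. by apply/O3P; exists 'X; rewrite map_polyX hornerX. Qed.

Lemma conj_O3 z : z \in O3 -> z^* \in O3.
Proof.
move=> /O3P[p ->]; rewrite -horner_map /= conj_tau -map_poly_comp.
rewrite (eq_map_poly (g := intr)) => [|n /=]; last by rewrite rmorph_int.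
apply: rpred_horner; last by rewrite rpredB ?rpred1 ?tau_O3.
by apply/polyOverP => i; rewrite coef_map /= rpred_int.
Qed.

Lemma Jmx2 : Jmx *m Jmx = 1%:M.
Proof.
apply/matrixP => i j; rewrite !mxE !big_ord_recl big_ord0 !mxE /=.
by case: i j => [[|[|[|//]]] ?] [[|[|[|//]]] ?] /=; ring.
Qed.

Lemma Jmx_O3 : Jmx \is a mxOver O3.
Proof.
apply/mxOverP => i j; rewrite !mxE.
by case: i j => [[|[|[|//]]] ?] [[|[|[|//]]] ?] /=; rewrite ?rpred0 ?rpred1.
Qed.

Lemma amxJ : ctmx amx *m Jmx *m amx = Jmx.
Proof.
apply/matrixP => i j; rewrite !(mxE, big_ord_recl, big_ord0) /=.
have h := tau2.
by case: i j => [[|[|[|//]]] ?] [[|[|[|//]]] ?] /=;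
  rewrite ?conj_tau ?conjC0 ?conjC1; ring: h.
Qed.

Lemma bmxJ : ctmx bmx *m Jmx *m bmx = Jmx.
Proof.
have e1 : (- tau^*)^* = - tau by rewrite rmorphN /= conjCK.
have e2 : (-1)^* = -1 :> C by rewrite rmorphN rmorph1.
have e3 : (tau + 2)^* = 1 - tau + 2 by rewrite rmorphD /= conj_tau rmorph_nat.
have e4 : (- 2 * tau + 1)^* = - 2 * (1 - tau) + 1.
  by rewrite rmorphD rmorphM rmorphN rmorph_nat rmorph1 /= conj_tau.
apply/matrixP => i j; rewrite !(mxE, big_ord_recl, big_ord0) /=.
have h := tau2.
by case: i j => [[|[|[|//]]] ?] [[|[|[|//]]] ?] /=;
  rewrite ?e1 ?e2 ?e3 ?e4 ?conj_tau ?conjC0 ?conjC1; ring: h.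
Qed.

Section OfMatrix.
Variables (M : 'M[C]_3) (MJ : ctmx M *m Jmx *m M = Jmx)
  (MO : M \is a mxOver O3).

Let MK : (Jmx *m ctmx M *m Jmx) *m M = 1%:M.
Proof. by rewrite -!mulmxA (mulmxA (ctmx M)) MJ Jmx2. Qed.

Fact unitmx_of : M \in unitmx.
Proof. by case: (mulmx1_unit MK). Qed.

Definition glof : GL 3 C := MkGL unitmx_of.

Fact preservesJ_of : preservesJ glof.
Proof. exact/eqP. Qed.

Definition ujof : UJ := exist _ glof preservesJ_of.

Fact GLO3_of : glof \in GLO3.
Proof.
rewrite unfold_in /= MO /=.
have -> : invmx M = Jmx *m ctmx M *m Jmx.
  by rewrite -[RHS]mulmx1 -(mulmxV unitmx_of) mulmxA MK mul1mx.
rewrite !mxOverM ?Jmx_O3 //; apply/mxOverP => i j; rewrite !mxE.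
exact/conj_O3/(mxOverP MO).
Qed.

Fact inGamma3_of : inGamma3 (cosetg _ ujof).
Proof. by apply/asboolP; exists ujof; split; first exact: GLO3_of. Qed.

Definition Gamma3_class : Gamma3 := exist _ (cosetg _ ujof) inGamma3_of.

End OfMatrix.

Fact amx_O3 : amx \is a mxOver O3.
Proof.
apply/mxOverP => i j; rewrite !mxE.
by case: i j => [[|[|[|//]]] ?] [[|[|[|//]]] ?] /=;
  rewrite ?rpred0 ?rpred1 ?tau_O3.
Qed.

Fact bmx_O3 : bmx \is a mxOver O3.
Proof.
have tO := tau_O3; have tO' := conj_O3 tO.
have e1 : - tau^* \in O3 by rewrite rpredN.
have e2 : -1 \in O3 by rewrite rpredN1.
have e3 : tau + 2 \in O3 by rewrite rpredD ?rpred_nat.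
have e4 : - 2 * tau + 1 \in O3.
  by rewrite rpredD ?rpred1 // rpredM // rpredN rpred_nat.
apply/mxOverP => i j; rewrite !mxE.
by case: i j => [[|[|[|//]]] ?] [[|[|[|//]]] ?] /=; rewrite ?rpred0 ?rpred1.
Qed.

Definition gamma_a : Gamma3 := Gamma3_class amxJ amx_O3.
Definition gamma_b : Gamma3 := Gamma3_class bmxJ bmx_O3.

End Gamma3.

(* Main.v *)
From HB Require Import structures.
Require Import Defs.
From mathcomp Require Import all_boot all_order all_algebra.
From mathcomp Require Import zify ring lra.
From mathcomp Require Import boolp reals complex.

(* The relators give, for p = a b a b^-1, the relations e^2 = 1, [a, e] = 1, (p e)^3 = 1 and
   a p a = p^2; the last one, which is the delicate point, comes from the braid relation br_4.
   The subgroup P generated by a and p maps onto the stabiliser of the cusp (1, 0, 0), whose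
   elements are, up to units, Heisenberg translations times powers of a; a p a = p^2 suffices to
   write every element of P as t0^m t1^n v^k a^j, so this map is injective up to scalars.

   Give g the height |c|^2, where c is the lower left entry of its matrix.  It depends only on
   g P, and vanishes only at the cusp.  Suppose that c <> 0, that x in P makes g x e no higher
   than g, and that no neighbour x a^k p^(+-1) makes it lower.  Then g x e has less than 7/16
   of the height of g, and any two such x are joined by at most two neighbour steps at which the
   height stays below that of g.  Since (p e)^3 = 1 turns a neighbour step into a single e, any
   two descents from g are equivalent modulo the relators.  Hence each element of the presented
   group descends to P along decreasing heights, and one which acts as a scalar, being of
   height 0, lies in P and is trivial.  Surjectivity is Euclid's algorithm in the Eisenstein
   integers applied to the last row. *)

Set Implicit Arguments.
Unset Strict Implicit.
Unset Printing Implicit Defensive.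

Import Order.TTheory GRing.Theory Num.Theory.

(** * Consequences of the relators *)

Local Open Scope group_scope.

(** Let (c, d, q) be the last row of g and let x in P have translation part (w1, w2). The height of
    g x e is |c|^2 |w1 + (d/c) w2 + q/c|^2, and Re (q/c) = -|d/c|^2 / 2 since the row is isotropic.
    Thus (d/c, q/c) is a point of the Heisenberg group, the ratio of the heights is, up to
    normalisation, the fourth power of a Cygan distance, and comparing heights means proving
    polynomial inequalities in three real variables. The obstacle is a step between elements of
    equal height, where an induction on the height says nothing. So only local minima are compared,
    at which the height drops strictly. The threshold 7/16 makes the comparison finite: two local
    minima differ by a translation with |w1|^2 < 16 * 7/16 = 7, which leaves |w2|^2 = 0, 1, 3 or 4.
    The vertical translations by i sqrt 3 are too long for both ends to be that low, those with
    |w2|^2 = 1 are the neighbours, and for |w2|^2 = 3 or 4 a neighbour halfway between the two ends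
    is still lower than g. *)

Ltac gsimpl := rewrite ?expgS ?expg0 ?(invgM, invgK, invg1, mulgA, mul1g, mulg1);
  repeat (progress rewrite ?(mulgK, mulgVK, mulgV, mulVg, mul1g, mulg1)).

Section BraidCollapse.
Variable G : groupType.
Implicit Types x y u v l r : G.

(** One rewriting step in a word: the relation [u = v] is applied between the prefix [x] and the
    suffix [y]. The two remaining goals are mostly free reductions. *)
Lemma subst_word u v x y l r : u = v -> l = x * u * y -> x * v * y = r -> l = r.
Proof. by move=> -> -> ->. Qed.

(* [rel_bab], [rel_bb] and [rel_br] are b a b^-1 = a^-1 p, b^2 = s and br_4 after the substitution
   b = p e p^-1 a^-1 p^-1. *)
Variables a p e c d p' c' n n' : G.
Hypotheses (cE : c = p^-1 * a * p) (dE : d = a * p).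
Hypotheses (p'E : p' = e * p * e) (c'E : c' = e * c * e).
Hypotheses (nE : n = c^-1 * a * c) (n'E : n' = e * n * e).
Hypotheses (e2 : e * e = 1) (ea : e * a = a * e).
Hypothesis pe3 : (p * e) ^+ 3 = 1.
Hypothesis rel_bab : e * d^-1 * c * d * e = c^-1 * p.
Hypothesis rel_bb : e * d^-1 * e * d^-1 = c * e * c^-1.
Hypothesis rel_br : c * (e * d * e * a * (e * d * e)^-1) = e * d * e * a * (e * d * e)^-1 * c.

Lemma ee x : x * e * e = x. Proof. by rewrite -mulgA e2 mulg1. Qed.
Lemma eV : e^-1 = e. Proof. by rewrite -[LHS]mulg1 -e2 mulKg. Qed.
Ltac gse := gsimpl; rewrite ?eV; repeat (progress (rewrite ?ee ?e2; gsimpl)).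

Lemma e_pp'p : p * p' * p = e.
Proof. by rewrite ?p'E; apply: (subst_word (x := 1) (y := e) pe3); gse. Qed.
Lemma d_pc : d = p * c. Proof. by rewrite dE cE; gsimpl. Qed.
Lemma aE : a = p * c * p^-1. Proof. by rewrite cE; gsimpl. Qed.
Lemma conj_e x y : x = y -> e * x * e = e * y * e. Proof. by move->. Qed.

Lemma p'c' : p' * c' = c'^-1 * p' * c' * c^-1 * p.
Proof.
have h : (p' * c')^-1 * c' * (p' * c') = c^-1 * p.
  by rewrite -rel_bab d_pc p'E c'E; gse.
by apply: (subst_word (x := c'^-1 * p' * c') (y := 1) h); gsimpl.
Qed.

Lemma cpc : c * p * c = p * c * c'^-1 * p'.
Proof.
have := conj_e p'c'; rewrite ?p'E ?c'E; gse => h.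
by apply: (subst_word (x := c) (y := 1) h); rewrite ?p'E ?c'E; gse.
Qed.

(** Feeding [p'c'] and [cpc] into [rel_bb] gives a second expression for [e]; comparing it with
    [e_pp'p] isolates [p']. *)
Lemma e_mm'm : e = p * c * c' * c^-1 * p * c.
Proof.
have h4 : e = c^-1 * p * c * p' * c' * c.
  by apply: (subst_word (x := c^-1) (y := c) (esym (f_equal (fun x => x^-1) rel_bb)));
    rewrite ?p'E ?c'E ?d_pc; gse.
rewrite [LHS]h4.
apply: (subst_word (x := c^-1 * p * c) (y := c) p'c'); first by gsimpl.
apply: (subst_word (x := c^-1) (y := c' * c^-1 * p * c) (esym cpc)).
  by gsimpl.
by gsimpl.
Qed.

Lemma p'_eq : p' = c * c' * c^-1 * a.
Proof.
apply: (@mulgI _ p); apply: (@mulIg _ p); rewrite e_pp'p [LHS]e_mm'm aE.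
by gsimpl.
Qed.

Lemma p_eq : p = c' * c * c'^-1 * a.
Proof.
have := conj_e p'_eq; rewrite ?p'E ?c'E; gse => h.
by rewrite [LHS]h; gse; rewrite -?mulgA -?ea ?mulgA; gse.
Qed.

Lemma ap : a * p = p * c. Proof. by rewrite -dE d_pc. Qed.

Lemma ap' : a * p' = p' * c'.
Proof. by rewrite ?p'E ?c'E; gse; rewrite -ea -(mulgA e a) ap; gse. Qed.

Lemma n'_eq : n' = c'^-1 * a * c'.
Proof.
have ea' : a = e * a * e by rewrite ea ee.
by rewrite n'E nE c'E {1}ea'; gse.
Qed.

(** By [rel_bb] the conjugator e d e in [rel_br] equals d^-1 c e c^-1. Conjugating the resulting
    commutation by c^-1 d makes it one between [n] and its conjugate by [e]. *)
Lemma nn' : n * n' = n' * n.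
Proof.
have ede : e * d * e = d^-1 * c * e * c^-1.
  by apply: (subst_word (x := d^-1) (y := 1) (f_equal (fun x => x^-1) rel_bb)); gse.
have nc : n = c^-1 * d * c * d^-1 * c by rewrite nE dE cE; gsimpl.
have := rel_br; rewrite ede.
have -> : d^-1 * c * e * c^-1 * a * (d^-1 * c * e * c^-1)^-1 = d^-1 * c * n' * c^-1 * d.
  by rewrite n'E nE; gse.
by move=> h; rewrite {1 2}nc; apply: (subst_word (x := c^-1 * d) (y := d^-1 * c) h); gsimpl.
Qed.

(** Conjugating [nn'] by c' gives an element [a1] commuting with [a], and e = p a c a1 a. As [a]
    commutes with [e] and with a1 a, it commutes with p a c; moving it past [p] by [ap] leaves the
    braid relation. *)
Lemma aca : a * c * a = c * a * c.
Proof.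
pose a1 := c' * n * c'^-1.
have a1a : a * a1 = a1 * a.
  by apply: (subst_word (x := c') (y := c'^-1) (esym nn')); rewrite n'_eq /a1; gsimpl.
have eE : e = p * a * c * a1 * a.
  rewrite -[LHS]e_pp'p {2}p_eq /a1 nE.
  apply: (subst_word (x := p) (y := c * c'^-1 * a) (esym ap')); first by gsimpl.
  by rewrite p'_eq; gsimpl.
have h : a * (p * a * c) = p * a * c * a.
  apply: (@mulIg _ (a1 * a)).
  have -> : a * (p * a * c) * (a1 * a) = a * e by rewrite [in RHS]eE; gsimpl.
  rewrite -ea [in LHS]eE; gsimpl.
  by apply: (subst_word (x := p * a * c) (y := a) (esym a1a)); gsimpl.
apply: (@mulgI _ p); apply: (@mulIg _ 1).
move: h; rewrite !mulgA ap !mulg1 => h.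
by rewrite [RHS]h.
Qed.

(** The braid relation turns [n] into a c a^-1, hence [n'] into a c' a^-1, so [nn'] says that c and
    c' commute. Then [p_eq] collapses to p = c a, and [ap] concludes. *)
Lemma apa : a * p * a = p * p.
Proof.
have a2 : n = a * c * a^-1.
  by rewrite nE; apply: (subst_word (x := c^-1) (y := a^-1) aca); gsimpl.
have a2' : n' = a * c' * a^-1.
  have eaV : a^-1 * e = e * a^-1.
    by apply: (@mulgI _ a); rewrite !mulgA -ea; gsimpl.
  by rewrite n'E a2 c'E !mulgA ea -(mulgA _ a^-1) eaV !mulgA.
have cc' : c * c' = c' * c.
  have := nn'; rewrite a2 a2' => h.
  by apply: (subst_word (x := a^-1) (y := a) h); gsimpl.
have h : p = c * a by rewrite [LHS]p_eq -cc'; gsimpl.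
by rewrite ap -mulgA -h.
Qed.
End BraidCollapse.

Section Relators.
Variable G : groupType.
Implicit Types x y : G.
Variables a b e s p : G.
Hypotheses (sE : s = b * b) (pE : p = a * b * a * b^-1).
Hypothesis eE : e = b * a^-1 * b^-1 * a^-1 * a^-1 * s * a * a * b * a * b^-1.
Hypotheses (ss : s * s = 1) (e2 : e * e = 1) (ea : e * a = a * e).
Hypothesis ab3 : (a * b) ^+ 3 = 1.
Hypothesis h3 : (a^-1 * s * a * a * b * a * b^-1) ^+ 3 = 1.
Hypothesis br4 : a * s * a^-1 * (s * a^-1 * s) * (a * s * a^-1) * (s * a^-1 * s) =
  s * a^-1 * s * (a * s * a^-1) * (s * a^-1 * s) * (a * s * a^-1).

(** The word p e freely reduces to the word h of the presentation. *)
Lemma pe3 : (p * e) ^+ 3 = 1.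
Proof. by rewrite -[RHS]h3 pE eE; congr (_ ^+ 3); gsimpl. Qed.

Lemma s_eq : s = a * p * e * p^-1 * a^-1.
Proof. by rewrite pE eE; gsimpl. Qed.

Lemma b_eq : b = p * e * p^-1 * a^-1 * p^-1.
Proof.
have hp : p = b^-1 * a^-1 * b^-1 * b^-1.
  by rewrite pE; apply: (subst_word (x := 1) (y := b^-1 * a^-1 * b^-1 * b^-1) ab3); gsimpl.
have hb : b^-1 = p * s * a by rewrite hp sE; gsimpl.
by rewrite -[LHS]invgK hb s_eq; gsimpl; rewrite (eV e2).
Qed.

Lemma relator_apa : a * p * a = p * p.
Proof.
have e_V := eV e2; have e_K := ee e2.
have [c cE] : exists c, c = p^-1 * a * p by eexists.
have [d dE] : exists d, d = a * p by eexists.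
have r1 : e * d^-1 * c * d * e = c^-1 * p.
  have : b * a * b^-1 = a^-1 * p by rewrite pE; gsimpl.
  rewrite [in LHS]b_eq; gsimpl; rewrite e_V => h.
  rewrite ?dE ?cE; gsimpl.
  by apply: (subst_word (x := p^-1) (y := p) h); gsimpl.
have r2 : e * d^-1 * e * d^-1 = c * e * c^-1.
  have : b * b = a * p * e * p^-1 * a^-1 by rewrite -sE -s_eq.
  rewrite [in LHS]b_eq; gsimpl => h.
  rewrite ?dE ?cE; gsimpl.
  by apply: (subst_word (x := p^-1) (y := p) h); gsimpl.
have r3 : c * (e * d * e * a * (e * d * e)^-1) = e * d * e * a * (e * d * e)^-1 * c.
  have hs : s = p * (c * e * c^-1) * p^-1 by rewrite s_eq cE; gsimpl.
  have ha : a = p * c * p^-1 by rewrite cE; gsimpl.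
  have hdc : d * c * d^-1 = a by rewrite ?dE ?cE; gsimpl.
  have hu : e * d * e * d = e * c * e * c^-1 * e.
    by apply: (subst_word (x := e) (y := e) (f_equal (fun x => x^-1) r2));
      gsimpl; rewrite ?e_V ?e_K; gsimpl; rewrite ?e_K.
  (* Conjugating by p c turns br_4 into a relation between [c] and [e] alone. *)
  have hf : c * e * c^-1 * e * c^-1 * e * c * e * c^-1 * e * c^-1 * e =
      e * c^-1 * e * c * e * c^-1 * e * c^-1 * e * c * e * c^-1.
    apply: (subst_word (x := c^-1 * p^-1) (y := p * c) br4); rewrite hs ha.
      by gsimpl.
    by gsimpl.
  have hX : forall y, y = e * c * e * c^-1 * e -> c * (y * c * y^-1) = y * c * y^-1 * c.
    move=> y ->; apply: (subst_word (x := e) (y := e) (f_equal (fun x => x^-1) hf));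
      by gsimpl; rewrite ?e_V ?e2; gsimpl; rewrite ?e_K.
  (* Since a = d c d^-1, conjugating [a] by e d e is conjugating [c] by e d e d, an element that
     [hu] writes in [c] and [e]. *)
  have -> : e * d * e * a * (e * d * e)^-1 = e * d * e * d * c * (e * d * e * d)^-1.
    by rewrite -hdc; gsimpl.
  exact: hX.
exact: (@apa G a p e c d _ _ _ _ cE dE erefl erefl erefl erefl e2 ea pe3 r1 r2 r3).
Qed.
End Relators.

(** * Integer powers in a group *)

Lemma int_step (P : int -> Prop) : P 0%R ->
  (forall z, P z -> P (z + 1)%R) -> (forall z, P z -> P (z - 1)%R) -> forall z, P z.
Proof.
move=> P0 Pp Pm [] n.
  by elim: n => [//|n /Pp]; rewrite -addn1 PoszD.
by elim: n => [|n /Pm]; [exact: (Pm _ P0) | congr P; lia].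
Qed.

Section IntPowers.
Variable G : groupType.
Implicit Types (x y : G) (m n z : int).

Definition zexp x z := match z with Posz n => x ^+ n | Negz n => x ^- n.+1 end.

Lemma zexpS x z : zexp x (z + 1)%R = zexp x z * x.
Proof.
case: z => n; first by rewrite -PoszD addn1 /= expgSr.
case: n => [|n]; first by rewrite /= expg1 mulVg.
have -> : (Negz n.+1 + 1 = Negz n)%R by lia.
by rewrite /= [in RHS]expgS invgM mulgVK.
Qed.

Lemma zexpB1 x z : zexp x (z - 1)%R = zexp x z * x^-1.
Proof. by apply: (@mulIg _ x); rewrite -zexpS mulgVK subrK. Qed.

Lemma zexpD x m n : zexp x (m + n)%R = zexp x m * zexp x n.
Proof.
elim/int_step: n => [|n IH|n IH]; first by rewrite addr0 mulg1.
  by rewrite addrA !zexpS IH mulgA.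
by rewrite addrA !zexpB1 IH mulgA.
Qed.

Lemma zexpN x m : zexp x (- m)%R = (zexp x m)^-1.
Proof. by apply: (@mulIg _ (zexp x m)); rewrite -zexpD addNr mulVg. Qed.

Lemma commute_zexp x y m : commute x y -> commute (zexp x m) y.
Proof.
move=> xy; elim/int_step: m => [|m IH|m IH]; first exact/commute_sym/commute1.
  by rewrite zexpS; apply/commute_sym/commuteM; apply: commute_sym.
by rewrite zexpB1; apply/commute_sym/commuteM; [|apply: commuteV]; apply: commute_sym.
Qed.

Lemma zexp_conj x y m : y * zexp x m * y^-1 = zexp (y * x * y^-1) m.
Proof.
elim/int_step: m => [|m IH|m IH]; first by rewrite mulg1 mulgV.
  by rewrite !zexpS -IH; gsimpl.
by rewrite !zexpB1 -IH; gsimpl.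
Qed.
End IntPowers.

(** * Words in the cusp group *)

Section Parabolic.
Variable G : groupType.
Implicit Types (x y g : G) (m n k : int).
Variables a p t0 t1 vt : G.
Hypotheses (t0E : t0 = p * a^-1 * a^-1) (t1E : t1 = a * t0 * a^-1).
Hypothesis vtE : vt = p * p * p.
Hypotheses (a6 : a ^+ 6 = 1) (apa : a * p * a = p * p).

Definition tr m n k := zexp t0 m * zexp t1 n * zexp vt k.

Lemma vt_p : commute vt p. Proof. by rewrite /commute vtE !mulgA. Qed.
(** Replacing either pair of adjacent factors of p^3 by a p a gives both (p a)^2 and (a p)^2. *)
Lemma vt_a : commute vt a.
Proof.
have e1 : vt = p * a * p * a by rewrite vtE -(mulgA p p) -apa !mulgA.
have e2 : vt = a * p * a * p by rewrite vtE -apa.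
by rewrite /commute {1}e2 e1 !mulgA.
Qed.
Lemma vt_t0 : commute vt t0.
Proof. by rewrite t0E; exact: (commuteM (commuteM vt_p (commuteV vt_a)) (commuteV vt_a)). Qed.
Lemma vt_t1 : commute vt t1.
Proof. by rewrite t1E; exact: (commuteM (commuteM vt_a vt_t0) (commuteV vt_a)). Qed.

Lemma VpapV : p^-1 * a * p = p * a^-1.
Proof. by apply: (@mulgI _ p); apply: (@mulIg _ a); rewrite !mulgA mulgV mul1g mulgVK. Qed.

(** Multiplication by tau sends tau to tau - 1, and the lift to the Heisenberg group acquires no
    vertical term. *)
Lemma a_t1 : a * t1 * a^-1 = t0^-1 * t1.
Proof.
have -> : t0^-1 * t1 = a * a * (p^-1 * a * p) * a^-1 * a^-1 * a^-1.
  by rewrite !t1E !t0E; gsimpl.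
by rewrite VpapV !t1E !t0E; gsimpl.
Qed.

(** The Heisenberg commutation law; the order six of [a] enters through a^-3 = a^3. *)
Lemma t1_t0 : t1 * t0 = t0 * t1 * vt.
Proof.
have h3 : a^-1 * a^-1 * a^-1 = a * a * a.
  apply: (@mulIg _ (a * a * a)); gsimpl; apply: esym.
  by rewrite -[RHS]a6; gsimpl.
have -> : t0 * t1 * vt = t0 * (a * p * a^-1) * vt * a^-1 * a^-1.
  have va x : x * a^-1 * vt = x * vt * a^-1.
    by rewrite -mulgA -(commuteV vt_a) mulgA.
  by rewrite t1E {2}t0E !mulgA !va.
have -> : t0 * (a * p * a^-1) * vt = p * p * a * a * p.
  have e1 : vt = a * p * a * p by rewrite vtE -apa.
  have -> : t0 * (a * p * a^-1) * vt = p * a^-1 * p * p * (a * p).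
    by rewrite {1}e1 t0E; gsimpl.
  have Vpp : a^-1 * p * p = p * a by rewrite -mulgA -apa; gsimpl.
  have -> : p * a^-1 * p * p = p * (a^-1 * p * p) by gsimpl.
  by rewrite Vpp; gsimpl.
rewrite !t1E !t0E; gsimpl.
have -> : a * p * a^-1 * a^-1 * a^-1 * p = a * p * (a * a * a) * p by rewrite -h3; gsimpl.
by rewrite !mulgA apa.
Qed.

Lemma t1_zexp m : t1 * zexp t0 m = zexp t0 m * t1 * zexp vt m.
Proof.
elim/int_step: m => [|m IH|m IH]; first by rewrite /= !mulg1 mul1g.
- rewrite !zexpS mulgA IH -!mulgA; congr (_ * _).
  have -> : zexp vt m * t0 = t0 * zexp vt m by apply: commute_zexp; exact: vt_t0.
  rewrite !mulgA t1_t0 -!mulgA; congr (_ * (_ * _)).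
  by apply/commute_sym/commute_zexp.
- rewrite !zexpB1 mulgA IH -!mulgA; congr (_ * _).
  have -> : zexp vt m * t0^-1 = t0^-1 * zexp vt m.
    by apply: commute_zexp; apply: commuteV; exact: vt_t0.
  have -> : t1 * (t0^-1 * zexp vt m) = t0^-1 * t1 * (vt^-1 * zexp vt m).
    rewrite !mulgA; congr (_ * _); apply: (@mulIg _ vt); rewrite mulgVK.
    rewrite -mulgA -(commuteV vt_t0) mulgA; apply: (@mulIg _ t0).
    by apply: (@mulgI _ t0); rewrite mulgVK !mulgA mulgV mul1g t1_t0.
  rewrite -!mulgA; congr (_ * (_ * _)).
  exact/commute_sym/commute_zexp/commuteV.
Qed.

Lemma t1z_t0z m n :
  zexp t1 n * zexp t0 m = zexp t0 m * zexp t1 n * zexp vt (n * m)%R.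
Proof.
have cv (k : int) : commute (zexp vt k) t1 by apply: commute_zexp; exact: vt_t1.
elim/int_step: n => [|n IH|n IH]; first by rewrite mul0r /= !mulg1 mul1g.
- rewrite zexpS mulrDl mul1r zexpD -mulgA t1_zexp !mulgA IH.
  by rewrite -!mulgA; congr (_ * (_ * _)); rewrite !mulgA cv.
- rewrite zexpB1 mulrBl mul1r zexpD zexpN.
  have h : t1^-1 * zexp t0 m = zexp t0 m * t1^-1 * (zexp vt m)^-1.
    apply: (@mulgI _ t1); apply: (@mulIg _ (zexp vt m)); rewrite !mulgA mulgV mul1g mulgVK t1_zexp.
    by rewrite -!mulgA; congr (_ * _); rewrite mulgA -cv mulgK.
  rewrite -mulgA h !mulgA IH.
  by rewrite -!mulgA; congr (_ * (_ * _)); rewrite !mulgA (commuteV (cv _)).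
Qed.

Lemma vt_tr k m n : commute (zexp vt k) (zexp t0 m * zexp t1 n).
Proof.
apply: commute_zexp; apply: commuteM; apply/commute_sym/commute_zexp/commute_sym.
  exact: vt_t0.
exact: vt_t1.
Qed.

Definition in_tr x := exists m n k, x = tr m n k.

Lemma in_trM x y : in_tr x -> in_tr y -> in_tr (x * y).
Proof.
move=> [m [n [k ->]]] [m' [n' [k' ->]]].
exists (m + m')%R, (n + n')%R, (n * m' + k + k')%R; rewrite /tr.
have -> : zexp t0 m * zexp t1 n * zexp vt k * (zexp t0 m' * zexp t1 n' * zexp vt k') =
    zexp t0 m * zexp t1 n * (zexp vt k * (zexp t0 m' * zexp t1 n')) * zexp vt k'.
  by rewrite !mulgA.
rewrite vt_tr.
have -> : zexp t0 m * zexp t1 n * (zexp t0 m' * zexp t1 n' * zexp vt k) * zexp vt k' =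
    zexp t0 m * (zexp t1 n * zexp t0 m') * zexp t1 n' * zexp vt k * zexp vt k'.
  by rewrite !mulgA.
have cv : zexp vt (n * m')%R * zexp t1 n' = zexp t1 n' * zexp vt (n * m')%R.
  by apply: commute_zexp; apply/commute_sym/commute_zexp/commute_sym; exact: vt_t1.
by rewrite t1z_t0z !zexpD !mulgA -(mulgA _ (zexp vt _) (zexp t1 n')) cv !mulgA.
Qed.

Lemma in_trz x z : in_tr x -> in_tr x^-1 -> in_tr (zexp x z).
Proof.
move=> hx hxV; elim/int_step: z => [|z IH|z IH].
- by exists 0%R, 0%R, 0%R; rewrite /tr /= !mul1g.
- by rewrite zexpS; exact: in_trM.
- by rewrite zexpB1; exact: in_trM.
Qed.

Lemma in_tr_t0 m : in_tr (zexp t0 m).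
Proof. by exists m, 0%R, 0%R; rewrite /tr /= !mulg1. Qed.
Lemma in_tr_t1 m : in_tr (zexp t1 m).
Proof. by exists 0%R, m, 0%R; rewrite /tr /= mulg1 mul1g. Qed.
Lemma in_tr_vt m : in_tr (zexp vt m).
Proof. by exists 0%R, 0%R, m; rewrite /tr /= !mul1g. Qed.

Lemma in_trV x : in_tr x -> in_tr x^-1.
Proof.
move=> [m [n [k ->]]]; rewrite /tr !invgM -!zexpN.
exact: in_trM (in_tr_vt _) (in_trM (in_tr_t1 _) (in_tr_t0 _)).
Qed.

Lemma in_tr_conj x : in_tr x -> in_tr (a * x * a^-1).
Proof.
move=> [m [n [k ->]]].
have -> : a * tr m n k * a^-1 =
    zexp t1 m * zexp (t0^-1 * t1) n * zexp vt k.
  have h3 : zexp vt k = a * zexp vt k * a^-1.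
    by rewrite -(commute_zexp k vt_a) mulgK.
  have h1 : zexp t1 m = a * zexp t0 m * a^-1 by rewrite zexp_conj -t1E.
  by rewrite -a_t1 -zexp_conj h1 [zexp vt k in RHS]h3 /tr; gsimpl.
apply: in_trM (in_tr_vt _); apply: in_trM (in_tr_t1 _) _.
have h : in_tr (t0^-1 * t1).
  by apply: in_trM; [apply: in_trV; exact: (in_tr_t0 1%R) | exact: (in_tr_t1 1%R)].
by apply: in_trz => //; exact: in_trV.
Qed.

Lemma in_tr_conjX x j : in_tr x -> in_tr (a ^+ j * x * a ^- j).
Proof.
move=> hx; elim: j => [|j IH]; first by rewrite expg0 mul1g invg1 mulg1.
by rewrite expgS invgM !mulgA -(mulgA a) -(mulgA a); exact: in_tr_conj.
Qed.

Definition in_par g := exists x j, in_tr x /\ g = x * a ^+ j.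

Lemma in_parM x y : in_par x -> in_par y -> in_par (x * y).
Proof.
move=> [u [i [hu ->]]] [v [j [hv ->]]]; exists (u * (a ^+ i * v * a ^- i)), (i + j)%N.
split; first by apply: in_trM => //; exact: in_tr_conjX.
by rewrite expgnDr; gsimpl.
Qed.

Lemma in_par_tr x : in_tr x -> in_par x.
Proof. by move=> hx; exists x, 0%N; rewrite mulg1. Qed.
Lemma in_par_aX j : in_par (a ^+ j).
Proof. by exists 1, j; split; [exact: (in_tr_t0 0%R) | rewrite mul1g]. Qed.

Lemma aXV j : a ^- j = a ^+ (5 * j).
Proof.
by apply: (@mulIg _ (a ^+ j)); rewrite mulVg -expgnDr -mulSnr expgnA a6 expg1n.
Qed.

Lemma in_parV x : in_par x -> in_par x^-1.
Proof.
move=> [u [j [hu ->]]]; rewrite invgM aXV.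
by apply: in_parM; [exact: in_par_aX | apply/in_par_tr/in_trV].
Qed.

Lemma in_par_p : in_par p.
Proof.
exists t0, 2%N; split; first exact: (in_tr_t0 1%R).
by rewrite t0E; gsimpl.
Qed.
End Parabolic.

(** * Descent along heights *)

Section Descent.
Variable G : groupType.
Implicit Types (x y g : G).
Variables (par : G -> Prop) (a p e : G) (ht : G -> nat).
Hypotheses (parM : forall x y, par x -> par y -> par (x * y))
  (parV : forall x, par x -> par x^-1).
Hypotheses (par_a : forall j, par (a ^+ j)) (par_p : par p).
Hypotheses (e2 : e * e = 1) (ea : e * a = a * e) (pe3 : (p * e) ^+ 3 = 1).

Variable nbr : nat -> bool -> G.
Hypothesis nbrE : forall k b, nbr k b = a ^+ k * (if b then p else p^-1).

Hypothesis ht_par : forall g x, par x -> ht (g * x) = ht g.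
Hypothesis ht0 : forall g, par g -> ht g = 0%N.
Hypothesis ht_e : forall g, ht g = 0%N -> (0 < ht (g * e))%N.

Definition local_min g := forall k b, (ht (g * e) <= ht (g * nbr k b * e))%N.

Hypothesis local_min_lt : forall g, (0 < ht g)%N -> (ht (g * e) <= ht g)%N ->
  local_min g -> (ht (g * e) < ht g)%N.
Hypothesis local_min_link : forall g x, (0 < ht g)%N ->
  (ht (g * e) <= ht g)%N -> local_min g -> par x ->
  (ht (g * x * e) <= ht g)%N -> local_min (g * x) ->
  [\/ exists j, x = a ^+ j, exists k b j, x = nbr k b * a ^+ j |
      exists k b k' b' j, x = nbr k b * nbr k' b' * a ^+ j /\
        (ht (g * nbr k b * e) < ht g)%N].

(* g is joined to the cusp by steps g |-> g x e, x parabolic, that lower the height. *)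
Inductive good : G -> Prop :=
| good_par g : par g -> good g
| good_desc g x : par x -> (ht (g * x * e) < ht g)%N -> good (g * x * e) -> good g.

Lemma par1 : par 1. Proof. exact: (par_a 0). Qed.

Lemma par_nbr k b : par (nbr k b).
Proof. by rewrite nbrE; apply: parM => //; case: b => //; exact: parV. Qed.

Lemma good_mulr g x : par x -> good g -> good (g * x).
Proof.
move=> hx hg; case: hg => [h hh|h y hy lt hg]; first by apply: good_par; exact: parM.
apply: (@good_desc _ (x^-1 * y)); first by apply: parM => //; exact: parV.
  by rewrite mulgA mulgK (ht_par h hx).
by rewrite mulgA mulgK.
Qed.

Lemma good_ht0 g : good g -> ht g = 0%N -> par g.
Proof. by case=> // h x _ lt _ h0; rewrite h0 in lt. Qed.

(** As [e] is an involution, the step back from g e to g is a descent. *)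
Lemma good_ascend g : good g -> (ht g < ht (g * e))%N -> good (g * e).
Proof.
move=> hg lt; apply: (@good_desc _ 1); rewrite ?mulg1 -?mulgA ?e2 ?mulg1 //.
exact: par1.
Qed.

(* Then g y e = (g e) x e z: the step y from one descent to another costs a single e. *)
Definition flips y := exists x z, [/\ par x, par z & e * y * e = x * e * z].

Lemma flipsV y : flips y -> flips y^-1.
Proof.
move=> [x [z [hx hz h]]]; exists z^-1, x^-1; split; try exact: parV.
have eV : e^-1 = e by rewrite -[LHS]mulg1 -e2 mulKg.
by have := congr1 (fun x => x^-1) h; rewrite !invgM eV !mulgA.
Qed.

Lemma aX_e j : e * a ^+ j = a ^+ j * e.
Proof. exact/commuteX. Qed.

Lemma flips_nbr k b : flips (nbr k b).
Proof.
have eV : e^-1 = e by rewrite -[LHS]mulg1 -e2 mulKg.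
have epe : e * p * e = p^-1 * e * p^-1.
  apply: (@mulgI _ p); apply: (@mulIg _ (p * e)).
  move: pe3; rewrite expgS expgS expg1 !mulgA => ->.
  by rewrite mulgV mul1g mulgVK e2.
have epVe : e * p^-1 * e = p * e * p.
  by have := congr1 (fun x => x^-1) epe; rewrite !invgM !invgK eV !mulgA.
rewrite nbrE; case: b.
  exists (a ^+ k * p^-1), p^-1; split; try by [apply: parM => //; exact: parV | exact: parV].
  by rewrite !mulgA aX_e -!mulgA (mulgA e) epe !mulgA.
exists (a ^+ k * p), p; split=> //; first exact: parM.
by rewrite !mulgA aX_e -!mulgA (mulgA e) epVe !mulgA.
Qed.

Section Step.
Variable n : nat.
Hypothesis IH : forall g x, (ht g < n)%N -> good g -> par x ->
  (ht (g * x * e) < n)%N -> good (g * x * e).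

(** Going from g e to g y e costs x e z, whose single [e] joins two elements of height below n and
    is covered by [IH]. *)
Lemma good_flip g y : flips y -> (ht (g * e) < n)%N -> (ht (g * y * e) < n)%N ->
  good (g * e) -> good (g * y * e).
Proof.
move=> [x [z [hx hz h]]] lt1 lt2 hg.
have eq : g * y * e = g * e * x * e * z.
  have -> : g * e * x * e * z = g * e * (x * e * z) by rewrite !mulgA.
  by rewrite -h !mulgA -(mulgA _ e e) e2 mulg1.
rewrite eq; apply: good_mulr => //; apply: IH => //.
by rewrite -(ht_par _ hz) -eq.
Qed.

(** Neighbours that lower the height are followed until none is left. Goodness passes from [y] back
    to [x] even when g x e has height exactly n, but from [x] to [y] only below n, because [IH] says
    nothing at height n. *)
Lemma good_to_local_min g : (0 < n)%N -> ht g = n -> forall m x, par x ->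
    ht (g * x * e) = m -> (m <= n)%N ->
  exists y, [/\ par y, local_min (g * y), (ht (g * y * e) < n)%N,
    good (g * y * e) -> good (g * x * e) &
    (ht (g * x * e) < n)%N -> good (g * x * e) -> good (g * y * e)].
Proof.
move=> n0 hg; elim/ltn_ind => m IHm x hx hm mn.
have [hF|/existsNP[k /existsNP[b /negP]]] := pselect (local_min (g * x)).
  exists x; split=> //; rewrite -hg -(ht_par g hx).
  by apply: local_min_lt; rewrite ?(ht_par g hx) ?hg ?hm.
rewrite -ltnNge hm.
have := par_nbr k b; have := flips_nbr k b; move: (nbr k b) => w hf hw lt.
have lt' := leq_trans lt mn.
have [|y [py Fy lty gy yg]] := IHm _ lt (x * w) (parM hx hw) _ (leq_trans (ltnW lt) mn).
  by rewrite mulgA.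
exists y; split=> // [{}gy'|ltx gx]; last first.
  by apply: yg; rewrite mulgA //; apply: good_flip => //; rewrite hm.
have {}gy := gy gy'; rewrite mulgA in gy.
have [ltx|gex] := ltnP (ht (g * x * e)) n.
  rewrite -(mulgK w (g * x)); apply: good_flip => //; first exact: flipsV.
  by rewrite mulgK.
(* Here g x e has height n, out of reach of [IH]. It equals g x w e u e v, so it is reached from the
   lower element g x w e u by an ascent. *)
have [u [v [hu hv h]]] := flipsV hf.
have eq : g * x * e = g * x * w * e * u * e * v.
  have -> : g * x * w * e * u * e * v = g * x * w * e * (u * e * v).
    by rewrite !mulgA.
  by rewrite -h !mulgA -(mulgA _ e e) e2 mulg1 mulgK.
rewrite eq; apply: good_mulr => //; apply: good_ascend; first exact: good_mulr.
by rewrite (ht_par _ hu) -(ht_par (g * x * w * e * u * e) hv) -eq; exact: leq_trans lt' gex.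
Qed.

(** A known descent [u] of g and the given step [x] are both moved to local minima [v] and [y], and
    [local_min_link] joins [v] to [y] by at most two neighbour steps that stay below n. *)
Lemma good_step g : (0 < n)%N -> ht g = n -> good g -> forall x, par x ->
  (ht (g * x * e) <= n)%N -> good (g * x * e).
Proof.
move=> n0 hg gg x hx le.
have [u hu [ltu gu]] : exists2 u, par u & (ht (g * u * e) < n)%N /\ good (g * u * e).
  case: gg hg => [h ph|h u hu lt gu] hh; first by rewrite ht0 // in hh; rewrite -hh in n0.
  by exists u => //; rewrite -hh.
have [y [py Fy lty yx xy]] := good_to_local_min n0 hg hx erefl le.
have [v [pv Fv ltv vu uv]] := good_to_local_min n0 hg hu erefl (ltnW ltu).
apply: yx; have {uv gu vu} gv := uv ltu gu.
have pw : par (v^-1 * y) by apply: parM => //; exact: parV.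
have yE : y = v * (v^-1 * y) by rewrite mulVKg.
have hgv : ht (g * v) = n by rewrite (ht_par g pv).
have nbr_step z k b j w : ht z = n -> (ht (z * e) < n)%N -> good (z * e) ->
    w = nbr k b * a ^+ j -> (ht (z * w * e) < n)%N -> good (z * w * e).
  move=> hz hze gze -> ; rewrite !mulgA -(mulgA _ (a ^+ j) e) -aX_e !mulgA (ht_par _ (par_a j)) => lt.
  by apply: good_mulr => //; apply: good_flip => //; exact: flips_nbr.
have := @local_min_link (g * v) (v^-1 * y); rewrite hgv !mulgA mulgK.
case=> //; try exact: ltnW.
- move=> [j hj]; rewrite yE hj !mulgA -(mulgA _ (a ^+ j)) -aX_e mulgA.
  exact: good_mulr.
- move=> [k [b [j hj]]]; rewrite yE hj mulgA.
  by apply: (nbr_step _ k b j) => //; rewrite -hj mulgA mulgK.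
- move=> [k [b [k' [b' [j [hj lt]]]]]]; rewrite yE hj !mulgA.
  have g1 : good (g * v * nbr k b * e) by apply: good_flip => //; exact: flips_nbr.
  rewrite -(mulgA (g * v * nbr k b)).
  apply: (nbr_step _ k' b' j) => //; first by rewrite (ht_par _ (par_nbr k b)).
  suff -> : g * v * nbr k b * (nbr k' b' * a ^+ j) = g * y by [].
  by rewrite [in RHS]yE hj !mulgA.
Qed.
End Step.

Lemma good_mul_e n g x : (ht g < n)%N -> good g -> par x ->
  (ht (g * x * e) < n)%N -> good (g * x * e).
Proof.
elim: n g x => // n IH g x ltg gg hx ltx.
have [h|h] := ltnP (ht g) (ht (g * x * e)).
  by apply: good_ascend; [exact: good_mulr | rewrite ht_par].
have [n0|n0] := posnP (ht g).
  have h0 : ht (g * x * e) = 0%N by apply/eqP; rewrite -leqn0 -n0.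
  by have := ht_e (etrans (ht_par g hx) n0); rewrite h0.
apply: (@good_step (ht g)) => // {}g' x' lt1 gg' hx' lt2.
by apply: IH => //; [exact: leq_trans lt1 ltg | exact: leq_trans lt2 ltg].
Qed.

Lemma good_e g : good g -> good (g * e).
Proof.
move=> gg; rewrite -(mulg1 g).
by apply: (@good_mul_e (maxn (ht g) (ht (g * 1 * e))).+1) => //;
  rewrite ?ltnS ?leq_maxl ?leq_maxr //; exact: par1.
Qed.
End Descent.

Local Close Scope group_scope.
Local Open Scope ring_scope.

(** * Real inequalities *)

Section CyganInequalities.
Variable R : realFieldType.
Implicit Types x v w s r : R.

(* The pair (x, v) stands for the complex number x + i sqrt(3) v, so that [nrm] is the squared modulus,
   [rot6] multiplication by tau, and [(-1/2, half b)] a primitive cube root of unity. *)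
Definition nrm x v := x ^+ 2 + 3 * v ^+ 2.
Definition rot6 (z : R * R) := ((z.1 - 3 * z.2) / 2, (z.1 + z.2) / 2).
Definition half (b : bool) : R := if b then 1 / 2 else - (1 / 2).

(* The neighbour inequalities of [sector_bound], solved for s: K for k = 0, Q for k = 1 and 5. *)
Definition Q x w r := 1 + 3 / 2 * r - 2 * x - r * (x + 3 * w) / 2.
Definition K x v r := 1 + 3 / 2 * r - (1 + r) * x - 3 * v.

Lemma Q_lt0 x w r : r = nrm x w -> 1 < x -> 0 <= w -> 3 * w <= x -> Q x w r < 0.
Proof.
rewrite /nrm => hr x1 w0 wx.
have e1 : 0 < (x - 1) * (1 - x + x ^+ 2 / 2) by apply: mulr_gt0; [lra | nra].
have e2 : 0 <= w * (x ^+ 2 + 3 * w ^+ 2 - w * (3 - x)) by apply: mulr_ge0; nra.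
have -> : Q x w r = - ((x - 1) * (1 - x + x ^+ 2 / 2))
    - 3 / 2 * (w * (x ^+ 2 + 3 * w ^+ 2 - w * (3 - x))) by rewrite /Q hr; lra.
lra.
Qed.

(** The prefixes [lower] and [upper] refer to the sign of v in [sector_bound]; here w = -v. If x >
    1, the two constraints bound s from opposite sides, and eliminating s by cross multiplication
    gives 0 a negative upper bound. *)
Lemma lower_x_le1 x w s r : r = nrm x w -> 0 <= s -> 0 <= w -> 3 * w <= x ->
  3 * s * (1 - x + w) <= Q x w r -> 3 * s * (x + w - 1) <= Q x (- w) r -> x <= 1.
Proof.
move=> hr s0 w0 wx cp cm; rewrite leNgt; apply/negP => x1.
have q := Q_lt0 hr x1 w0 wx; rewrite /nrm in hr.
have xw : 1 + w < x.
  rewrite ltNge; apply/negP => h.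
  have : 0 <= s * (1 - x + w) by [apply: mulr_ge0; lra]; lra.
have k1 : 3 * s * (x + w - 1) * (x - 1 - w) <= Q x (- w) r * (x - 1 - w).
  by apply: ler_wpM2r => //; lra.
have k2 : 3 * s * (1 - x + w) * (x + w - 1) <= Q x w r * (x + w - 1).
  by apply: ler_wpM2r => //; lra.
have e1 : 0 < (x - 1) ^+ 2 * (1 - x + x ^+ 2 / 2).
  by apply: mulr_gt0; [rewrite exprn_gt0 //; lra | nra].
have e2 : 0 <= w ^+ 2 * (r - (3 - x) * (x - 1)).
  by apply: mulr_ge0; [exact: sqr_ge0 | nra].
have : Q x (- w) r * (x - 1 - w) + Q x w r * (x + w - 1) =
    - 2 * ((x - 1) ^+ 2 * (1 - x + x ^+ 2 / 2))
    - 3 * (w ^+ 2 * (r - (3 - x) * (x - 1))) by rewrite /Q hr; lra.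
lra.
Qed.

Lemma lower_s x w s r : r = nrm x w -> 0 <= s -> 0 < w -> 3 * w <= x -> x <= 1 ->
  3 * s * (1 - x + w) <= Q x w r -> 3 * s <= 27 / 25 - x / 2.
Proof.
rewrite /nrm => hr s0 w0 wx x1 cp; rewrite leNgt; apply/negP => h.
have h1 : (27 / 25 - x / 2) * (1 - x + w) <= 3 * s * (1 - x + w).
  by apply: ler_wpM2r; lra.
have k1 : 0 <= x * (1 - x) ^+ 2 by apply: mulr_ge0; [lra | exact: sqr_ge0].
pose B := 1 - x / 2 + 3 / 2 * x ^+ 2 + 9 / 2 * w ^+ 2 - 9 / 2 * w + 3 / 2 * x * w.
have k2 : 0 <= w * B by rewrite /B; apply: mulr_ge0; [lra | nra].
have k3 : Q x w r = (1 - x / 2) * (1 - x + w) - x * (1 - x) ^+ 2 / 2 - w * B.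
  by rewrite /Q /B hr; lra.
lra.
Qed.

Lemma lower_r x w r : r = nrm x w -> 0 <= w -> 3 * w <= x -> x <= 1 ->
  0 <= Q x w r -> r <= x + 3 / 25.
Proof.
rewrite /nrm => hr w0 wx x1; rewrite /Q hr => q; rewrite leNgt; apply/negP => h.
have hx : 9 / 25 <= x * (4 / 3 * x - 1) + 6 / 25 by nra.
have x8 : 21 / 25 <= x by nra.
have w1 : 1 / 5 <= w by nra.
nra.
Qed.

(** Again s is eliminated, now between the neighbours k = 0 and k = 5, with the multipliers 1 + v -
    x and 1 - 2 v. *)
Lemma upper_x_le1 x v s r : r = nrm x v -> r <= 2 -> 0 <= s -> 0 <= v ->
  3 * v <= x -> 3 * s * (1 - 2 * v) <= K x v r ->
  0 <= Q x v r + 3 * s * (1 + v - x) -> x <= 1.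
Proof.
move=> hr r2 s0 v0 vx c1 cm; rewrite leNgt; apply/negP => x1.
have q := Q_lt0 hr x1 v0 vx; rewrite /nrm in hr.
have x3 : x <= 3 / 2 by nra.
have xv : x < 1 + v.
  rewrite ltNge; apply/negP => h.
  have : s * (1 + v - x) <= 0 by [apply: mulr_ge0_le0; lra]; lra.
have n0 : 0 <= K x v r by apply: le_trans c1; apply: mulr_ge0; lra.
have v5 : v <= 1 / 5 by move: n0; rewrite /K hr; clear -x1 v0 vx xv; nra.
have k1 : 3 * s * (1 - 2 * v) * (1 + v - x) <= K x v r * (1 + v - x).
  by apply: ler_wpM2r; lra.
have hq : 3 / 2 * v * (1 - 2 * v) <= - Q x v r.
  have h1 : 0 <= (x - 1) * (1 - x + x ^+ 2 / 2) by apply: mulr_ge0; [lra | nra].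
  have h2 : 0 <= v * (x ^+ 2 + 3 * v ^+ 2 - v * (3 - x) - (1 - 2 * v)).
    by apply: mulr_ge0 => //; nra.
  by rewrite /Q hr; lra.
have hn : K x v r <= 1 / 2 - 3 * v + 3 / 2 * v ^+ 2.
  have h1 : 0 <= (x - 1) * (1 + 3 / 2 * (x - 1) + (x - 1) ^+ 2 + 3 * v ^+ 2).
    by apply: mulr_ge0; [lra | nra].
  by rewrite /K hr; lra.
have hq' : 3 / 2 * v * (1 - 2 * v) * (1 - 2 * v) <= - Q x v r * (1 - 2 * v).
  by apply: ler_wpM2r; lra.
have hn1 : (1 + v - x) * K x v r <= v * K x v r by apply: ler_wpM2r; lra.
have hn2 : v * K x v r <= v * (1 / 2 - 3 * v + 3 / 2 * v ^+ 2).
  by apply: ler_wpM2l; lra.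
have k2 : - Q x v r * (1 - 2 * v) <= 3 * s * (1 + v - x) * (1 - 2 * v).
  by apply: ler_wpM2r; lra.
have : 0 < v * (1 - 3 * v + 9 / 2 * v ^+ 2) by apply: mulr_gt0; [lra | nra].
lra.
Qed.

Lemma upper_s x v s r : r = nrm x v -> 0 <= s -> 0 <= v -> 3 * v <= x -> x <= 1 ->
  3 * s * (1 - 2 * v) <= K x v r -> 3 * s <= 27 / 25 - x / 2.
Proof.
rewrite /nrm => hr s0 v0 vx x1 c1; rewrite leNgt; apply/negP => h.
have h2 : (27 / 25 - x / 2) * (1 - 2 * v) <= K x v r.
  by apply: le_trans c1; apply: ler_wpM2r; lra.
(* On [0, 1] the cubic x (1 - x) (x - 1/2) is maximal at (3 + sqrt 3) / 6, close to 79/100, and the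
   factor x + 2/25 matches the terms of degree two. At v = 0 this cubic is the excess of [K] over 1
   - x/2, whence the slack in 27/25. *)
have k0 : 0 <= (x - 79 / 100) ^+ 2 * (x + 2 / 25).
  by apply: mulr_ge0; [exact: sqr_ge0 | lra].
have k1 : x * (1 - x) * (x - 1 / 2) <= 3 / 50 by lra.
have k2 : 0 <= v * (1 + x + 3 * x * v - 9 / 2 * v - 4 / 25).
  by apply: mulr_ge0 => //; nra.
by move: h2; rewrite /K hr; nra.
Qed.

Lemma upper_r x v r : r = nrm x v -> 0 <= v -> 3 * v <= x -> x <= 1 ->
  0 <= K x v r -> r <= x + 3 / 25.
Proof.
rewrite /nrm => hr v0 vx x1; rewrite /K => q; rewrite leNgt; apply/negP => h.
have x8 : 21 / 25 <= x by nra.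
have v1 : 1 / 5 + 1 / 2 * (1 - x) <= v by nra.
have hf : 1 - x + 3 / 2 * x ^+ 2 - x ^+ 3 <= 1 / 2 + (1 - x) by nra.
by move: q; rewrite hr; nra.
Qed.

(** The resulting bound (x + 3/25)^2 / 4 + (27/25 - x/2)^2 / 3 is convex in x, with values about
    0.393 at 0 and 0.426 at 1, both below 7/16 = 0.4375. *)
Lemma height_bound x s r : 0 <= r -> 0 <= x -> 0 <= s -> r <= x + 3 / 25 -> x <= 1 ->
  3 * s <= 27 / 25 - x / 2 -> nrm (- r / 2) s < 7 / 16.
Proof.
move=> r0 x0 s0 rx x1 hs.
have hs2 : (3 * s) ^+ 2 <= (27 / 25 - x / 2) ^+ 2.
  by rewrite ler_pXn2r // ?nnegrE; lra.
have hr2 : r ^+ 2 <= (x + 3 / 25) ^+ 2 by rewrite ler_pXn2r // ?nnegrE; lra.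
by rewrite /nrm; nra.
Qed.

(** The sector of half angle 30 degrees about the positive real axis is a fundamental domain for
    [rot6]. Three of the twelve neighbours suffice on it, and the sign of v decides which two of
    them are used. *)
Lemma sector_bound x v s (r := nrm x v) : 0 <= s -> - x <= 3 * v -> 3 * v <= x ->
  nrm (- r / 2) s <= 1 ->
  (forall k b, k \in [:: 0%N; 1%N; 5%N] -> nrm (- r / 2) s <=
     nrm (- r / 2 + (iter k rot6 (x, v)).1 - 1 / 2)
         (s + (iter k rot6 (x, v)).2 + half b)) ->
  nrm (- r / 2) s < 7 / 16.
Proof.
have hr : r = nrm x v by []. clearbody r.
move=> s0 vx xv h1 hF.
have r0 : 0 <= r by rewrite hr /nrm; nra.
have r2 : r <= 2 by move: h1; rewrite /nrm; clear -r0 => h1; nra.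
have := hF 0%N false isT; have := hF 1%N false isT; have := hF 5%N true isT.
rewrite /nrm /= /half => f5 f1 f0.
have c1 : 3 * s * (1 - 2 * v) <= K x v r by rewrite /K; move: hr f0; rewrite /nrm; clear => hr f; lra.
have cp : 3 * s * (1 - x - v) <= Q x (- v) r.
  by rewrite /Q; move: hr f1; rewrite /nrm; clear => hr f; lra.
have cm : 0 <= Q x v r + 3 * s * (1 + v - x).
  by rewrite /Q; move: hr f5; rewrite /nrm; clear => hr f; lra.
have [v0|v0] := leP 0 v.
  have x1 := upper_x_le1 hr r2 s0 v0 xv c1 cm.
  have k0 : 0 <= K x v r by apply: le_trans c1; apply: mulr_ge0; lra.
  apply: (@height_bound x) => //; first lra.
    exact: upper_r hr v0 xv x1 k0.
  exact: upper_s hr s0 v0 xv x1 c1.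
have hr' : r = nrm x (- v) by rewrite hr /nrm sqrrN.
have w0 : 0 < - v by lra.
have wx : 3 * (- v) <= x by lra.
have x1 : x <= 1 by apply: (lower_x_le1 hr' s0 (ltW w0) wx); rewrite ?opprK; lra.
apply: (@height_bound x) => //; first lra.
  apply: (lower_r hr' (ltW w0) wx x1); apply: le_trans cp; apply: mulr_ge0; lra.
by apply: (lower_s hr' s0 w0 wx x1); lra.
Qed.

Lemma nrm_rot6 k z : nrm (iter k rot6 z).1 (iter k rot6 z).2 = nrm z.1 z.2.
Proof. by elim: k => //= k <-; rewrite /nrm /rot6 /=; lra. Qed.

Lemma sector_exists z : exists k, let y := iter k rot6 z in
  - y.1 <= 3 * y.2 /\ 3 * y.2 <= y.1.
Proof.
case: z => x v.
have [h1|h1] := leP (3 * v) x; have [h2|h2] := leP (- x) (3 * v).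
- by exists 0%N.
- by have [h3|h3] := leP 0 x; [exists 1%N | exists 2%N]; rewrite /= /rot6 /=; lra.
- by have [h3|h3] := leP 0 x; [exists 5%N | exists 4%N]; rewrite /= /rot6 /=; lra.
- by exists 3%N; rewrite /= /rot6 /=; lra.
Qed.

Definition conj2 (z : R * R) := (z.1, - z.2).

(** Conjugation inverts the rotation, and the inverse of a rotation of order six is its fifth
    power. *)
Lemma iter_rot6_conj k z : iter k rot6 (conj2 z) = conj2 (iter (5 * k)%N rot6 z).
Proof.
elim: k => [|k IH] //; rewrite iterS IH mulnS iterD.
by case: (iter (5 * k)%N rot6 z) => y w; rewrite /conj2 /= /rot6 /=; congr pair; lra.
Qed.

(* Here (x, v) is d / c and s is the imaginary coordinate of e / c, for (c, d, e) the last row of a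
   matrix; the real part of e / c is -r / 2 because the row is isotropic. *)
Lemma local_min_bound x v s (r := nrm x v) : nrm (- r / 2) s <= 1 ->
  (forall k b, nrm (- r / 2) s <=
     nrm (- r / 2 + (iter k rot6 (x, v)).1 - 1 / 2)
         (s + (iter k rot6 (x, v)).2 + half b)) ->
  nrm (- r / 2) s < 7 / 16.
Proof.
wlog s0 : v s @r / 0 <= s => [hw h1 hF|].
  have [s0|s0] := leP 0 s; first exact: hw.
  have hr : nrm x (- v) = r by rewrite /r /nrm sqrrN.
  have hs : forall y t, nrm y (- t) = nrm y t by move=> y t; rewrite /nrm sqrrN.
  rewrite -hs -hr; apply: hw; rewrite ?hr ?hs //; first lra.
  move=> k b; rewrite -[(x, - v)]/(conj2 (x, v)) iter_rot6_conj /=.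
  have -> : - s - (iter (5 * k)%N rot6 (x, v)).2 + half b =
      - (s + (iter (5 * k)%N rot6 (x, v)).2 + half (~~ b)).
    by rewrite /half; case: (b) => /=; lra.
  by rewrite hs; exact: hF.
move=> h1 hF; have [k [k1 k2]] := sector_exists (x, v).
move: k1 k2; case E : (iter k rot6 (x, v)) => [y w] /= k1 k2.
have hr : nrm y w = r by have := nrm_rot6 k (x, v); rewrite E.
rewrite -hr; apply: sector_bound; rewrite ?hr // => j b _.
by rewrite -E -iterD; exact: hF.
Qed.

(** Recentring d/c at half the conjugate of the horizontal translation 2, that is at 1, makes the
    two ends symmetric: in the average of the two hypotheses the linear terms cancel, so k and u are
    small. The sign of u selects the vertical position of the neighbour. *)
Lemma opposite_common_neighbour x v s (r := nrm x v) :
  nrm (- r / 2) s < 7 / 16 -> nrm (- r / 2 + 2 * x - 2) (s + 2 * v) < 7 / 16 ->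
  exists b, nrm (- r / 2 + x - 1 / 2) (s + v + half b) < 1.
Proof.
move=> h1 h2.
pose p := x - 1; pose u := s + v; pose k := nrm p v.
have hx : x = 1 + p by rewrite /p; lra.
have hs : s = u - v by rewrite /u; lra.
have k0 : 0 <= k by rewrite /k /nrm; nra.
have hrk : r = 1 + 2 * p + k by rewrite /r hx /k /nrm; lra.
have hk : (1 + k) ^+ 2 / 4 + k + 3 * u ^+ 2 < 7 / 16.
  have -> : (1 + k) ^+ 2 / 4 + k + 3 * u ^+ 2 =
      (nrm (- r / 2) s + nrm (- r / 2 + 2 * x - 2) (s + 2 * v)) / 2.
    by rewrite hrk hs hx /nrm /k /nrm; lra.
  lra.
have hk2 : k <= 1 / 8 by nra.
have hu : u ^+ 2 <= 1 / 16 by nra.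
have hk3 : k ^+ 2 <= 1 by clear -k0 hk2; nra.
exists (u <= 0); rewrite hrk hx.
have -> : - (1 + 2 * p + k) / 2 + (1 + p) - 1 / 2 = - k / 2 by lra.
by rewrite /nrm -/u /half; have [u0|u0] := leP u 0; lra.
Qed.

(** The same averaging, recentred at half the conjugate of 1 + tau, that is at (3/4, -1/4). The
    linear term in j survives and is absorbed by the squares [i1] to [i4]. *)
Lemma sqrt3_common_neighbour x v s (r := nrm x v) :
  nrm (- r / 2) s < 7 / 16 ->
  nrm (- r / 2 + 3 / 2 * (x - v) - 3 / 2) (s + (3 * v + x) / 2 + 1 / 2) < 7 / 16 ->
  nrm (- r / 2 + x - 1 / 2) (s + v + 1 / 2) < 1.
Proof.
move=> h1 h2.
pose p := x - 3 / 4; pose q := v + 1 / 4; pose k := nrm p q.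
pose j := p + 3 * q; pose m := p - q; pose u := s + (1 + j) / 4.
have hx : x = 3 / 4 + p by rewrite /p; lra.
have hv : v = q - 1 / 4 by rewrite /q; lra.
have hs : s = u - (1 + j) / 4 by rewrite /u; lra.
have hkm : 4 * k = 3 * m ^+ 2 + j ^+ 2 by rewrite /k /m /j /nrm; lra.
have hrk : r = 3 / 4 + 3 / 2 * m + k by rewrite /r /nrm hx hv /k /nrm /m; lra.
have hk : 9 / 8 * k + k ^+ 2 / 4 + 3 / 8 * j + 3 * u ^+ 2 < 7 / 64.
  have -> : 9 / 8 * k + k ^+ 2 / 4 + 3 / 8 * j + 3 * u ^+ 2 =
    (nrm (- r / 2) s + nrm (- r / 2 + 3 / 2 * (x - v) - 3 / 2)
       (s + (3 * v + x) / 2 + 1 / 2)) / 2 - 21 / 64.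
    by rewrite hrk hs hx hv /nrm /k /m /j /nrm; lra.
  lra.
have -> : - r / 2 + x - 1 / 2 = j / 4 - k / 2 - 1 / 8 by rewrite hrk hx /m /j; lra.
have -> : s + v + 1 / 2 = u - m / 4 by rewrite hs hv /m /j; lra.
have i1 := sqr_ge0 (u + m / 4); have i2 := sqr_ge0 m.
have i3 := sqr_ge0 (k + j / 2); have i4 := sqr_ge0 (j + 1).
by rewrite /nrm; nra.
Qed.

End CyganInequalities.

(** * Eisenstein integers *)

Section Coordinates.
Variable R : realType.
Local Notation C := R[i].
Local Notation tau := (tau C).
Implicit Types x y z : C.

(** This is sqrt 3, read off from tau so that Eisenstein integers get half-integral coordinates
    [cre] and [cim]. *)
Let s3 : R := 2 * complex.Im tau.
Definition cre z : R := complex.Re z.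
Definition cim z : R := complex.Im z / s3.
Definition N z : R := nrm (cre z) (cim z).

Lemma creD x y : cre (x + y) = cre x + cre y. Proof. by case: x y => [? ?] [? ?]. Qed.
Lemma creN x : cre (- x) = - cre x. Proof. by case: x. Qed.
Lemma cimD x y : cim (x + y) = cim x + cim y.
Proof. by case: x y => [? ?] [? ?]; rewrite /cim /= mulrDl. Qed.
Lemma cimN x : cim (- x) = - cim x. Proof. by case: x => ? ?; rewrite /cim /= mulNr. Qed.

Let ReIm_tau : complex.Re tau = 1 / 2 /\ (complex.Im tau) ^+ 2 = 3 / 4.
Proof.
have := conj_tau C; have := tau2 C; case: (tau) => u v.
move=> /eqP; rewrite eq_complex /= => /andP[/eqP h1 /eqP h2].
move=> /eqP; rewrite eq_complex /= => /andP[/eqP h3 /eqP h4].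
have hu : u = 1 / 2 by lra.
by split=> //; move: h1; rewrite hu; lra.
Qed.

Let s3sq : s3 ^+ 2 = 3. Proof. by have [_] := ReIm_tau; rewrite /s3; lra. Qed.
Let s3_neq0 : s3 != 0.
Proof. by apply/eqP => h; move: s3sq; rewrite h; lra. Qed.

Lemma creM x y : cre (x * y) = cre x * cre y - 3 * (cim x * cim y).
Proof.
case: x y => [u v] [u' v']; rewrite /cre /cim /= -s3sq.
by field.
Qed.
Lemma cimM x y : cim (x * y) = cre x * cim y + cim x * cre y.
Proof. by case: x y => [u v] [u' v']; rewrite /cre /cim /=; field. Qed.
Lemma cre_conj z : cre z^* = cre z. Proof. by case: z. Qed.
Lemma cim_conj z : cim z^* = - cim z. Proof. by case: z => u v; rewrite /cim /= mulNr. Qed.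
Lemma cre_tau : cre tau = 1 / 2. Proof. by case: ReIm_tau. Qed.
Lemma cim_tau : cim tau = 1 / 2.
Proof. by rewrite /cim /s3; field; rewrite -[X in X != 0]/(complex.Im tau); have := s3_neq0; rewrite /s3 mulf_eq0 negb_or => /andP[]. Qed.
Lemma cre0 : cre 0 = 0. Proof. by []. Qed.
Lemma cim0 : cim 0 = 0. Proof. by rewrite /cim mul0r. Qed.
Lemma cre1 : cre 1 = 1. Proof. by []. Qed.
Lemma cim1 : cim 1 = 0. Proof. by rewrite /cim mul0r. Qed.
Lemma cre_nat n : cre n%:R = n%:R.
Proof. by elim: n => // n IH; rewrite -addn1 natrD creD IH natrD. Qed.
Lemma cim_nat n : cim n%:R = 0.
Proof. by elim: n => [|n IH]; [exact: cim0 | rewrite -addn1 natrD cimD IH cim1 addr0]. Qed.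
Lemma cre_int (n : int) : cre n%:~R = n%:~R.
Proof. by case: n => n; rewrite ?NegzE ?mulrNz ?creN cre_nat. Qed.
Lemma cim_int (n : int) : cim n%:~R = 0.
Proof. by case: n => n; rewrite ?NegzE ?mulrNz ?cimN cim_nat ?oppr0. Qed.

Definition coordE := (cre_tau, cim_tau, cre0, cim0, cre1, cim1, cre_nat, cim_nat,
  cre_int, cim_int, cre_conj, cim_conj, creN, cimN, creD, cimD, creM, cimM).

Lemma coord_inj x y : cre x = cre y -> cim x = cim y -> x = y.
Proof.
case: x y => [u v] [u' v']; rewrite /cre /cim /= => -> /(congr1 ( *%R^~ s3)).
by rewrite !divfK // => ->.
Qed.

Lemma NM x y : N (x * y) = N x * N y.
Proof. by rewrite /N /nrm creM cimM; ring. Qed.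
Lemma N_conj z : N z^* = N z.
Proof. by rewrite /N /nrm cre_conj cim_conj sqrrN. Qed.
Lemma N0 : N 0 = 0. Proof. by rewrite /N /nrm cre0 cim0; ring. Qed.
Lemma N1 : N 1 = 1. Proof. by rewrite /N /nrm cre1 cim1; ring. Qed.
Lemma NN z : N (- z) = N z.
Proof. by rewrite /N /nrm creN cimN !sqrrN. Qed.
Lemma N_ge0 z : 0 <= N z.
Proof. by rewrite /N /nrm; nra. Qed.
Lemma N_eq0 z : (N z == 0) = (z == 0).
Proof.
apply/eqP/eqP => [|->]; last exact: N0.
rewrite /N /nrm => h.
have h1 : cre z = 0 by apply/eqP; rewrite -sqrf_eq0; apply/eqP; nra.
have h2 : cim z = 0 by apply/eqP; rewrite -sqrf_eq0; apply/eqP; nra.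
by apply: coord_inj; rewrite ?h1 ?h2 ?cim0.
Qed.
Lemma N_gt0 z : (0 < N z) = (z != 0).
Proof. by rewrite lt0r N_eq0 N_ge0 andbT. Qed.
Lemma N_tau : N tau = 1. Proof. by rewrite /N /nrm cre_tau cim_tau; lra. Qed.
Lemma N_mul_conj z : z * z^* = 1 <-> N z = 1.
Proof.
split=> [h|h].
  have := congr1 cre h; rewrite !coordE => {}h; rewrite /N /nrm; lra.
by apply: coord_inj; rewrite !coordE; move: h; rewrite /N /nrm; lra.
Qed.

Definition eis (m n : int) : C := m%:~R + n%:~R * tau.

Lemma eisD m n m' n' : eis m n + eis m' n' = eis (m + m') (n + n').
Proof. by rewrite /eis !intrD; ring. Qed.
Lemma eisM m n m' n' : eis m n * eis m' n' = eis (m * m' - n * n') (m * n' + n * m' + n * n').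
Proof. by rewrite /eis !(intrD, mulrNz, intrM); have h := tau2 C; ring: h. Qed.
Lemma eis_conj m n : (eis m n)^* = eis (m + n) (- n).
Proof. by rewrite /eis rmorphD rmorphM /= !rmorph_int conj_tau intrD mulrNz; ring. Qed.
Lemma tauE : tau = eis 0 1. Proof. by rewrite /eis add0r mul1r. Qed.
Lemma eis0 : eis 0 0 = 0. Proof. by rewrite /eis mul0r addr0. Qed.
Lemma eis1 : eis 1 0 = 1. Proof. by rewrite /eis mul0r addr0. Qed.

Lemma eis_inj m n m' n' : eis m n = eis m' n' -> m = m' /\ n = n'.
Proof.
move=> h; have := congr1 cim h; have := congr1 cre h; rewrite /eis !coordE => h1 h2.
have e2 : n%:~R = n'%:~R :> R by lra.
have e1 : m%:~R = m'%:~R :> R by lra.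
by split; apply/eqP; rewrite -(eqr_int R); apply/eqP.
Qed.

Lemma N_eis m n : N (eis m n) = (m ^+ 2 + m * n + n ^+ 2)%:~R.
Proof. by rewrite /N /nrm /eis !coordE !(intrD, intrM, rmorphXn) /=; lra. Qed.

Lemma O3_eis z : z \in @O3 C <-> exists m n, z = eis m n.
Proof.
split=> [/O3P[q ->]|[m [n ->]]]; last first.
  by rewrite rpredD ?rpred_int // rpredM ?rpred_int // tau_O3.
elim/poly_ind: q => [|q c [m [n IH]]].
  by exists 0, 0; rewrite rmorph0 horner0 eis0.
rewrite rmorphD rmorphM /= map_polyX map_polyC /= hornerMXaddC IH.
exists (m * 0 - n * 1 + c), (m * 1 + n * 0 + n * 1).
have -> : c%:~R = eis c 0 by rewrite /eis mul0r addr0.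
by rewrite [in LHS]tauE eisM eisD addr0.
Qed.

Lemma eis_units m n : N (eis m n) = 1 -> exists2 k, (k < 6)%N & eis m n = tau ^+ k.
Proof.
rewrite N_eis => /eqP; rewrite -[1]/(1%:~R) eqr_int => /eqP h.
have t2 : tau ^+ 2 = eis (-1) 1 by rewrite expr2 tauE eisM.
have t3 : tau ^+ 3 = eis (-1) 0 by rewrite exprS t2 tauE eisM.
have t4 : tau ^+ 4 = eis 0 (-1) by rewrite exprS t3 tauE eisM.
have t5 : tau ^+ 5 = eis 1 (-1) by rewrite exprS t4 tauE eisM.
have [[-> ->]|[[-> ->]|[[-> ->]|[[-> ->]|[[-> ->]|[-> ->]]]]]] :
  (m = 1 /\ n = 0) \/ (m = 0 /\ n = 1) \/ (m = -1 /\ n = 1) \/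
  (m = -1 /\ n = 0) \/ (m = 0 /\ n = -1) \/ (m = 1 /\ n = -1).
- have [h1 [h2 [h3 h4]]] : -1 <= m /\ m <= 1 /\ -1 <= n /\ n <= 1 by nia.
  nia.
- by exists 0%N; rewrite // expr0 eis1.
- by exists 1%N; rewrite // expr1 tauE.
- by exists 2%N; rewrite // t2.
- by exists 3%N; rewrite // t3.
- by exists 4%N; rewrite // t4.
- by exists 5%N; rewrite // t5.
Qed.

Lemma tau6 : tau ^+ 6 = 1.
Proof.
by rewrite !exprS expr0 mulr1 tauE !eisM -eis1; congr eis.
Qed.
End Coordinates.

(** * The universal property of the free group *)

Section FreeLift.
Local Open Scope group_scope.
Variables (X : choiceType) (G : groupType) (f : X -> G).

Definition letter_val (l : X * bool) := if l.2 then f l.1 else (f l.1)^-1.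
Definition word_val (w : seq (X * bool)) := foldr (fun l y => letter_val l * y) 1 w.

Lemma letter_valV l : letter_val (letter_inv l) = (letter_val l)^-1.
Proof. by case: l => x [] //=; rewrite /letter_val /= invgK. Qed.

Lemma word_val_push l w : word_val (push l w) = letter_val l * word_val w.
Proof.
case: w => [|m w] //=; case: eqP => [->|//].
by rewrite /= letter_valV mulgA mulgV mul1g.
Qed.

Definition free_lift (x : freeg X) := word_val (val x).

Lemma free_liftM : {morph free_lift : x y / x * y}.
Proof.
move=> x y; rewrite /free_lift /=; elim: (val x) => [|l w IH]; first by rewrite mul1g.
by rewrite /= word_val_push IH mulgA.
Qed.
Lemma free_lift1 : free_lift 1 = 1. Proof. by []. Qed.
Lemma free_liftV x : free_lift x^-1 = (free_lift x)^-1.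
Proof.
by apply: (@mulIg _ (free_lift x)); rewrite -free_liftM !mulVg.
Qed.
Lemma free_lift_gen x : free_lift (fgen x) = f x.
Proof. by rewrite /free_lift /= mulg1. Qed.
End FreeLift.

Section FreeInduction.
Local Open Scope group_scope.
Variable X : choiceType.

Lemma free_lift_fgen (x : freeg X) : free_lift (@fgen X) x = x.
Proof.
apply: val_inj; case: x => w /= rw; rewrite /free_lift /=.
elim: w rw => //= l w IH rw.
have {}IH := IH (path_sorted rw).
have push_w : push l w = l :: w.
  by case: w rw {IH} => //= m w /andP[/negPf ->].
by case: l rw push_w => x [] rw push_w /=; rewrite IH.
Qed.

Lemma hom_free_lift (G : groupType) (h : freeg X -> G) : {morph h : x y / x * y} ->
  forall x, h x = free_lift (fun i => h (fgen i)) x.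
Proof.
move=> hM x; rewrite -{1}(free_lift_fgen x) /free_lift.
have h1 : h 1 = 1 by apply: (@mulIg _ (h 1)); rewrite -hM !mul1g.
elim: (val x) => //= l w IH; rewrite hM IH; congr (_ * _).
rewrite /letter_val; case: ifP => // _.
by apply: (@mulIg _ (h (fgen l.1))); rewrite -hM !mulVg.
Qed.
End FreeInduction.

(** * Matrices of size 3 and their integer encoding *)

Definition i0 : 'I_3 := @Ordinal 3 0 isT.
Definition i1 : 'I_3 := @Ordinal 3 1 isT.
Definition i2 : 'I_3 := @Ordinal 3 2 isT.

Lemma forall_I3 (P : 'I_3 -> Prop) : P i0 -> P i1 -> P i2 -> forall i, P i.
Proof.
move=> h0 h1 h2 [[|[|[|//]]] h]; first by rewrite (_ : Ordinal h = i0) //; exact: val_inj.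
  by rewrite (_ : Ordinal h = i1) //; exact: val_inj.
by rewrite (_ : Ordinal h = i2) //; exact: val_inj.
Qed.

Lemma sum3 (V : nmodType) (F : 'I_3 -> V) : \sum_(i < 3) F i = F i0 + F i1 + F i2.
Proof.
rewrite !big_ord_recl big_ord0 addr0 addrA; congr (_ + _ + _); congr F; exact: val_inj.
Qed.

Lemma mulmx3E (K : pzRingType) (A B : 'M[K]_3) i j :
  (A *m B) i j = A i i0 * B i0 j + A i i1 * B i1 j + A i i2 * B i2 j.
Proof. by rewrite mxE sum3. Qed.

Section IntegerMatrices.
Variable R : realType.
Local Notation C := R[i].
Local Notation tau := (tau C).

(* A pair (m, n) stands for m + n tau; the entries outside the list are 0. *)
Definition lmx := seq (seq (int * int)).
Definition ent (A : lmx) i j := nth (0, 0) (nth [::] A i) j.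
Definition eadd (u v : int * int) := (u.1 + v.1, u.2 + v.2).
Definition emul (u v : int * int) := (u.1 * v.1 - u.2 * v.2, u.1 * v.2 + u.2 * v.1 + u.2 * v.2).
Definition econj (u : int * int) := (u.1 + u.2, - u.2).
Definition lmk (F : nat -> nat -> int * int) : lmx :=
  [:: [:: F 0%N 0%N; F 0%N 1%N; F 0%N 2%N]; [:: F 1%N 0%N; F 1%N 1%N; F 1%N 2%N];
      [:: F 2%N 0%N; F 2%N 1%N; F 2%N 2%N]].
Definition lmul (A B : lmx) := lmk (fun i j => eadd (eadd (emul (ent A i 0) (ent B 0 j))
  (emul (ent A i 1) (ent B 1 j))) (emul (ent A i 2) (ent B 2 j))).
(** The matrix J A^* J, which is the inverse of a J-unitary A; conjugation by J reverses both
    indices. *)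
Definition ladj (A : lmx) := lmk (fun i j => econj (ent A (2 - j) (2 - i))).
Definition lscalar (A : lmx) := A == lmk (fun i j => if i == j then ent A 0 0 else (0, 0)).

Definition eisp (u : int * int) : C := eis R u.1 u.2.
Definition mxe (A : lmx) : 'M[C]_3 := \matrix_(i, j) eisp (ent A i j).

Lemma eispD u v : eisp (eadd u v) = eisp u + eisp v. Proof. by rewrite /eisp eisD. Qed.
Lemma eispM u v : eisp (emul u v) = eisp u * eisp v. Proof. by rewrite /eisp eisM. Qed.
Lemma eisp_conj u : eisp (econj u) = (eisp u)^*. Proof. by rewrite /eisp eis_conj. Qed.

Lemma mxe_mk F : mxe (lmk F) = \matrix_(i, j) eisp (F i j).
Proof. by apply/matrixP; do 2!apply: forall_I3; rewrite !mxE. Qed.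

Lemma mxeM A B : mxe (lmul A B) = mxe A *m mxe B.
Proof. by apply/matrixP => i j; rewrite mxe_mk mulmx3E !mxE !eispD !eispM. Qed.

Lemma mxe_scalar A : lscalar A -> is_scalar_mx (mxe A).
Proof.
move=> /eqP ->; apply/is_scalar_mxP; exists (eisp (ent A 0 0)).
rewrite mxe_mk; apply/matrixP => i j; rewrite !mxE -val_eqE /=.
by case: eqP; rewrite ?mulr1n ?mulr0n // /eisp /= eis0.
Qed.

Definition umx (x : UJ C) : 'M[C]_3 := glval (val x).

Lemma umxM (x y : UJ C) : umx (x * y)%g = umx x *m umx y. Proof. by []. Qed.
Lemma umx1 : umx 1%g = 1%:M. Proof. by []. Qed.
Lemma umxJ (x : UJ C) : ctmx (umx x) *m Jmx C *m umx x = Jmx C.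
Proof. by apply/eqP; exact: (valP x). Qed.
Lemma umxV (x : UJ C) : umx x^-1%g = Jmx C *m ctmx (umx x) *m Jmx C.
Proof.
have h : (Jmx C *m ctmx (umx x) *m Jmx C) *m umx x = 1%:M.
  by rewrite -!mulmxA (mulmxA (ctmx _)) umxJ Jmx2.
have h2 : umx x *m umx x^-1%g = 1%:M by rewrite -umxM mulgV.
by rewrite -[LHS]mul1mx -h -(mulmxA _ (umx x)) h2 mulmx1.
Qed.

Lemma JmxE (A : 'M[C]_3) : Jmx C *m A *m Jmx C = \matrix_(i, j) A (rev_ord i) (rev_ord j).
Proof.
have e (i j k : 'I_3) : rev_ord i = k -> A (rev_ord i) (rev_ord j) = A k (rev_ord j) by move->.
apply/matrixP => i j; rewrite mulmx3E !mulmx3E !mxE.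
have r0 : rev_ord i0 = i2 by exact: val_inj.
have r1 : rev_ord i1 = i1 by exact: val_inj.
have r2 : rev_ord i2 = i0 by exact: val_inj.
by move: i j; do 2!apply: forall_I3; rewrite /= ?r0 ?r1 ?r2; ring.
Qed.

Lemma umxV_ladj (x : UJ C) A : umx x = mxe A -> umx x^-1%g = mxe (ladj A).
Proof.
move=> h; rewrite umxV h JmxE mxe_mk; apply/matrixP => i j; rewrite !mxE -eisp_conj.
by congr eisp; congr econj; congr ent; rewrite /= !subSS.
Qed.

End IntegerMatrices.

(** * The presented group and its matrices *)

Section MatrixRepresentation.
Variable R : realType.
Local Notation C := R[i].
Local Notation tau := (tau C).
Local Notation F := (freeg 'I_2).

Definition genU (i : 'I_2) : UJ C :=
  if val i == 0%N then ujof (amxJ C) else ujof (bmxJ C).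
Definition rho : F -> UJ C := free_lift genU.

Lemma rhoM : {morph rho : x y / (x * y)%g}. Proof. exact: free_liftM. Qed.
Lemma rhoV x : rho x^-1%g = (rho x)^-1%g. Proof. exact: free_liftV. Qed.

Definition la : lmx := [:: [:: (1, 0); (0, 0); (0, 0)]; [:: (0, 0); (0, 1); (0, 0)];
  [:: (0, 0); (0, 0); (1, 0)]].
Definition lb : lmx := [:: [:: (-1, 1); (-1, 0); (2, 1)]; [:: (1, 0); (1, 0); (1, -2)];
  [:: (1, 0); (0, 0); (1, -2)]].

Lemma amx_mxe : amx C = mxe R la.
Proof.
apply/matrixP; do 2!apply: forall_I3; rewrite !mxE /= /eisp /= ?eis0 ?eis1 //.
exact: tauE.
Qed.

Lemma bmx_mxe : bmx C = mxe R lb.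
Proof.
apply/matrixP; do 2!apply: forall_I3; rewrite !mxE /= ?conj_tau /eisp /= /eis ?mul0r ?addr0 //;
  by rewrite ?mulrNz; ring.
Qed.

Definition lletter (l : 'I_2 * bool) : lmx :=
  let A := if val l.1 == 0%N then la else lb in if l.2 then A else ladj A.
Definition lid : lmx := lmk (fun i j => if i == j then (1, 0) else (0, 0)).
Definition lword (w : seq ('I_2 * bool)) : lmx := foldr (fun l A => lmul (lletter l) A) lid w.

Lemma mxe_lid : mxe R lid = 1%:M.
Proof.
rewrite mxe_mk; apply/matrixP => i j; rewrite !mxE -val_eqE /=.
by case: eqP => _; rewrite /eisp /= ?eis1 ?eis0.
Qed.

Lemma umx_rho (x : F) : umx (rho x) = mxe R (lword (val x)).
Proof.
rewrite /rho /free_lift; elim: (val x) => [|l w IH]; first by rewrite /= mxe_lid.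
rewrite [word_val _ _]/= [lword _]/= umxM IH mxeM; congr (_ *m _).
rewrite /letter_val /lletter /genU; case: l => i [] /=; case: (_ == _).
- exact: amx_mxe.
- exact: bmx_mxe.
- exact: (umxV_ladj (amx_mxe : umx (ujof (amxJ C)) = _)).
- exact: (umxV_ladj (bmx_mxe : umx (ujof (bmxJ C)) = _)).
Qed.

(** The words that are trivial in PU(J). As a normal subgroup it can be tested against the normal
    closure of the relators. *)
Definition kerM : {pred F} := fun x => rho x \in @scalarUJ C.

Fact kerM_mul : mulg_closed kerM.
Proof. by move=> x y hx hy; rewrite unfold_in rhoM; exact: gpredM. Qed.
Fact kerM_one : (1 : F)%g \in kerM.
Proof. by rewrite unfold_in /rho free_lift1 gpred1. Qed.
Fact kerM_inv : invg_closed kerM.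
Proof. by move=> x hx; rewrite unfold_in rhoV gpredV. Qed.
Fact kerM_conj : {in kerM, forall x y, (x ^ y)%g \in kerM}.
Proof. by move=> x hx y; rewrite unfold_in !rhoM rhoV; exact: gpredJl. Qed.
HB.instance Definition _ := isMulClosed.Build F kerM kerM_mul.
HB.instance Definition _ := isMul1Closed.Build F kerM kerM_one.
HB.instance Definition _ := isInvClosed.Build F kerM kerM_inv.
HB.instance Definition _ := isConjClosed.Build F kerM kerM_conj.

Definition ga : F := fgen (ord0 : 'I_2).
Definition gb : F := fgen (ord_max : 'I_2).
Local Open Scope group_scope.
Definition we : F := gb * ga^-1 * gb^-1 * ga ^- 2 * gb ^+ 2 * ga ^+ 2 * gb * ga * gb^-1.
Definition wf : F := ga * gb ^- 2 * ga^-1.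
Definition wg : F := gb ^+ 2 * ga^-1 * gb ^+ 2.
Definition wh : F := ga^-1 * gb ^+ 2 * ga ^+ 2 * gb * ga * gb^-1.
Definition rels15 : seq (F * F) :=
     [:: (ga ^+ 6, 1); (gb ^+ 4, 1); (we ^+ 2, 1); (wf ^+ 2, 1); (wg ^+ 6, 1);
         (wh ^+ 3, 1); br 2 ga we; br 4 wf wg; ((ga * gb) ^+ 3, 1)].
Local Close Scope group_scope.

Lemma rels15_scalar : all (fun r : F * F => lscalar (lword (val (r.1 / r.2 : F)%g))) rels15.
Proof. by vm_compute. Qed.

Lemma kerM_rels : {subset [seq (r.1 / r.2)%g | r <- rels15] <= kerM}.
Proof.
move=> x /mapP[r hr ->]; rewrite unfold_in.
have := allP rels15_scalar _ hr => /(mxe_scalar R).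
by rewrite -umx_rho.
Qed.
End MatrixRepresentation.

(** * Relations in the presented group *)

Section PresentedGroup.
Local Notation F := (freeg 'I_2).
Definition Gpres := presented rels15.
HB.instance Definition _ := Group.on Gpres.
Definition prj : F -> Gpres := @cosetg _ _.

Local Open Scope group_scope.
Lemma prjM : {morph prj : x y / x * y}. Proof. by move=> x y; exact: cosetgM. Qed.
Lemma prjV x : prj x^-1 = (prj x)^-1. Proof. exact: cosetgV. Qed.
Lemma prj1 : prj 1 = 1. Proof. by []. Qed.
Lemma prjX x n : prj (x ^+ n) = prj x ^+ n.
Proof. by elim: n => [|n IH]; rewrite ?expg0 ?prj1 // !expgS prjM IH. Qed.

Lemma prj_rel r : r \in rels15 -> prj r.1 = prj r.2.
Proof.
move=> hr; have : prj (r.1 / r.2) = prj 1.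
  apply/esym/cosetgP; rewrite invg1 mul1g; apply/normal_closureP => N; apply.
  by apply/mapP; exists r.
by rewrite prjM prjV prj1 => /divg1_eq.
Qed.

Definition xa := prj ga.
Definition xb := prj gb.
Definition wp : F := ga * gb * ga * gb^-1.
Definition xp := prj wp.
Definition xe := prj we.

Let rel_at i (hi : (i < 9)%N) := prj_rel (mem_nth (1, 1) (hi : (i < size rels15)%N)).

Lemma xa6 : xa ^+ 6 = 1.
Proof. by have := @rel_at 0 isT; rewrite /= prjX. Qed.
Lemma xb4 : xb ^+ 4 = 1.
Proof. by have := @rel_at 1 isT; rewrite /= prjX. Qed.
Lemma xe2 : xe * xe = 1.
Proof. by have := @rel_at 2 isT; rewrite /= prjX expg2. Qed.
Lemma xea : xe * xa = xa * xe.
Proof.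
have : prj (ga * (we * 1)) = prj (we * (ga * 1)) := @rel_at 6 isT.
by rewrite !mulg1 (prjM ga we) (prjM we ga) => h; exact: esym.
Qed.
Lemma xab3 : (xa * xb) ^+ 3 = 1.
Proof. by have := @rel_at 8 isT; rewrite /= prjX prjM. Qed.

Lemma xpE : xp = xa * xb * xa * xb^-1. Proof. by rewrite /xp !prjM prjV. Qed.
Lemma xeE : xe = xb * xa^-1 * xb^-1 * xa^-1 * xa^-1 * (xb * xb) * xa * xa * xb * xa * xb^-1.
Proof.
by rewrite /xe /we !prjM !prjV ?prjX -/xa -/xb ?expg2 invgM !mulgA.
Qed.
Lemma xbb2 : xb * xb * (xb * xb) = 1.
Proof. by rewrite -[RHS]xb4 !expgS expg0 mulg1 !mulgA. Qed.
Lemma xh3 : (xa^-1 * (xb * xb) * xa * xa * xb * xa * xb^-1) ^+ 3 = 1.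
Proof.
have := @rel_at 5 isT; rewrite /= prjX => h; rewrite -[RHS]h; congr (_ ^+ 3).
by rewrite /wh !prjM !prjV ?prjX -/xa -/xb ?expg2 !mulgA.
Qed.
Lemma xbr4 : let s := xb * xb in
  xa * s * xa^-1 * (s * xa^-1 * s) * (xa * s * xa^-1) * (s * xa^-1 * s) =
  s * xa^-1 * s * (xa * s * xa^-1) * (s * xa^-1 * s) * (xa * s * xa^-1).
Proof.
have : prj (wf * (wg * (wf * (wg * 1)))) = prj (wg * (wf * (wg * (wf * 1)))) := @rel_at 7 isT.
rewrite !mulg1 !(prjM wf, prjM wg) /wf /wg !prjM !prjV ?prjX -/xa -/xb ?expg2.
have sV : (xb * xb)^-1 = xb * xb by rewrite -[LHS]mulg1 -xbb2 mulKg.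
by rewrite sV !mulgA.
Qed.

Lemma xpe3 : (xp * xe) ^+ 3 = 1. Proof. exact: (pe3 xpE xeE xh3). Qed.
Lemma xapa : xa * xp * xa = xp * xp.
Proof. exact: (relator_apa erefl xpE xeE xe2 xea xab3 xh3 xbr4). Qed.
Lemma xb_eq : xb = xp * xe * xp^-1 * xa^-1 * xp^-1.
Proof. exact: (b_eq erefl xpE xeE xe2 xab3). Qed.

Lemma prj_ind (Q : Gpres -> Prop) : Q 1 ->
  (forall g, Q g -> Q (g * xa)) -> (forall g, Q g -> Q (g * xa^-1)) ->
  (forall g, Q g -> Q (g * xb)) -> (forall g, Q g -> Q (g * xb^-1)) -> forall g, Q g.
Proof.
move=> Q1 Qa QaV Qb QbV g; rewrite -(cosetgK g) -/(prj _).
rewrite (hom_free_lift prjM) /free_lift -[word_val _ _]mul1g.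
elim: (val _) 1 Q1 => [|l w IH] h Qh /=; first by rewrite mulg1.
rewrite mulgA; apply: IH; rewrite /letter_val; case: l => [[[|[|//]] hi] b] /=.
  have -> : prj (fgen (Ordinal hi)) = xa by congr prj; congr fgen; exact: val_inj.
  by case: b; auto.
have -> : prj (fgen (Ordinal hi)) = xb by congr prj; congr fgen; exact: val_inj.
by case: b; auto.
Qed.
End PresentedGroup.

(** * Matrices of group elements up to unit scalars *)

Section Representatives.
Variable R : realType.
Local Notation C := R[i].
Local Notation tau := (tau C).
Local Notation N := (@N R).
Implicit Types (x y : Gpres) (A B : 'M[C]_3) (u w z l : C).

(* The matrix of an element of PU(J) is only defined up to a unit scalar. *)
Definition repm x B := exists2 l, N l = 1 & umx (rho R (repr x)) = l *: B.

Lemma scalarUJ_N (A : UJ C) l : umx A = l%:M -> N l = 1.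
Proof.
move=> h; apply/N_mul_conj; have := umxJ A; rewrite h.
move=> /matrixP/(_ i1 i1); rewrite mulmx3E !mulmx3E !mxE /=.
rewrite !(mulr0n, mulr1n, rmorph0, mul0r, mulr0, add0r, addr0, mulr1) => h1.
by rewrite mulrC.
Qed.

Lemma rho_eq (x' y' : freeg 'I_2) : prj x' = prj y' -> exists2 l, N l = 1 & umx (rho R y') = l *: umx (rho R x').
Proof.
move=> /cosetgP /normal_closureP /(_ (@kerM R)) h.
have := h (@kerM_rels R); rewrite unfold_in => /is_scalar_mxP[l hl].
have hN : N l = 1 by apply: (@scalarUJ_N (rho R (x'^-1 * y')%g)).
exists l => //.
have : umx (rho R x') *m umx (rho R (x'^-1 * y')%g) = umx (rho R y').
  by rewrite -umxM -rhoM mulVKg.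
by rewrite /umx hl => <-; rewrite scalar_mxC mul_scalar_mx.
Qed.

Lemma repm_prj (y : freeg 'I_2) : repm (prj y) (umx (rho R y)).
Proof. by apply: rho_eq; rewrite /prj cosetgK. Qed.

Lemma repm_repr x : repm x (umx (rho R (repr x))).
Proof. by exists 1; rewrite ?N1 ?scale1r. Qed.

Lemma repmZ x l B : N l = 1 -> repm x (l *: B) -> repm x B.
Proof. by move=> hl [l' hl' h]; exists (l' * l); rewrite ?NM ?hl ?hl' ?mulr1 // -scalerA. Qed.

Lemma repm_prjP (y : freeg 'I_2) B : repm (prj y) B <-> exists2 l, N l = 1 & umx (rho R y) = l *: B.
Proof.
have [l hl hy] := repm_prj y.
have l0 : l != 0 by rewrite -N_gt0 hl ltr01.
split=> [[l' hl' h']|[l' hl' h']].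
  exists (l^-1 * l').
    by rewrite NM hl' mulr1; apply: (mulfI (oner_neq0 R)); rewrite -{1}hl -NM mulfV // N1 mulr1.
  by rewrite -scalerA -h' hy scalerA mulVf ?scale1r.
by exists (l * l'); rewrite ?NM ?hl ?hl' ?mulr1 // hy h' scalerA.
Qed.

Lemma repmM x y A B : repm x A -> repm y B -> repm (x * y)%g (A *m B).
Proof.
rewrite -{1 2}(cosetgK x) -{1 2}(cosetgK y) -!/(prj _) -prjM.
move=> /repm_prjP[l hl hx] /repm_prjP[l' hl' hy]; apply/repm_prjP.
exists (l * l'); first by rewrite NM hl hl' mulr1.
by rewrite rhoM umxM hx hy -scalemxAl -scalemxAr scalerA.
Qed.

Lemma repm_uniq x A B : repm x A -> repm x B -> exists2 l, N l = 1 & A = l *: B.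
Proof.
move=> [l hl hx] [l' hl' hx']; have l0 : l != 0 by rewrite -N_gt0 hl ltr01.
exists (l^-1 * l').
  by rewrite NM hl' mulr1; apply: (mulfI (oner_neq0 R)); rewrite -{1}hl -NM mulfV // N1 mulr1.
by rewrite -scalerA -hx' hx scalerA mulVf ?scale1r.
Qed.

Lemma repm1 : repm 1%g 1%:M.
Proof. by apply/(@repm_prjP 1%g); exists 1; rewrite ?N1 // scale1r /rho free_lift1. Qed.

Lemma repmV x A B : repm x A -> A *m B = 1%:M -> repm x^-1%g B.
Proof.
move=> hx hAB; have := repmM (repm_repr x^-1%g) hx; rewrite mulVg => h.
have [l hl h1] := repm_uniq h repm1.
have hB : umx (rho R (repr x^-1%g)) = l *: B.
  by rewrite -[LHS]mulmx1 -hAB mulmxA h1 -scalemxAl mul1mx.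
by exists l.
Qed.

(** Heisenberg translations, rotations about the vertical axis, and the inversion exchanging the
    cusps (1, 0, 0) and (0, 0, 1). [Tmx w1 w2] preserves J exactly when [null w1 w2] holds. *)
Definition Tmx w1 w2 : 'M[C]_3 := mx3 [:: [:: 1; - w2^*; w1]; [:: 0; 1; w2]; [:: 0; 0; 1]].
Definition Dmx u : 'M[C]_3 := mx3 [:: [:: 1; 0; 0]; [:: 0; u; 0]; [:: 0; 0; 1]].
Definition Emx : 'M[C]_3 := mx3 [:: [:: 0; 0; -1]; [:: 0; 1; 0]; [:: -1; 0; 0]].

Lemma TmxM u1 u2 w1 w2 : Tmx u1 u2 *m Tmx w1 w2 = Tmx (u1 + w1 - u2^* * w2) (u2 + w2).
Proof.
apply/matrixP; do 2!apply: forall_I3; rewrite mulmx3E !mxE /= ?rmorphD; ring.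
Qed.
Lemma DmxM u w : Dmx u *m Dmx w = Dmx (u * w).
Proof. by apply/matrixP; do 2!apply: forall_I3; rewrite mulmx3E !mxE /=; ring. Qed.
Lemma Tmx00 : Tmx 0 0 = 1%:M.
Proof. by apply/matrixP; do 2!apply: forall_I3; rewrite !mxE /= ?rmorph0 ?oppr0. Qed.
Lemma Dmx1 : Dmx 1 = 1%:M.
Proof. by apply/matrixP; do 2!apply: forall_I3; rewrite !mxE. Qed.
Lemma DTmx u w1 w2 : N u = 1 -> Dmx u *m Tmx w1 w2 = Tmx w1 (u * w2) *m Dmx u.
Proof.
move=> /N_mul_conj hu.
apply/matrixP; do 2!apply: forall_I3; rewrite !mulmx3E !mxE /= ?rmorphM /=; 
  ring: hu.
Qed.

Definition null w1 w2 := w1 + w1^* + w2 * w2^* = 0.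

Lemma TmxV w1 w2 : null w1 w2 -> Tmx w1 w2 *m Tmx w1^* (- w2) = 1%:M.
Proof.
move=> h; rewrite TmxM subrr mulrN opprK -Tmx00; congr Tmx.
by rewrite -h; ring.
Qed.

Lemma nullN w1 w2 : null w1 w2 -> null w1^* (- w2).
Proof. by rewrite /null conjCK rmorphN /= mulrNN => <-; ring. Qed.

Lemma Ntau k : N (tau ^+ k) = 1.
Proof. by elim: k => [|k IH]; rewrite ?expr0 ?N1 // exprS NM N_tau mul1r. Qed.

Lemma repm_a : repm xa (Dmx tau).
Proof.
apply/repm_prjP; exists 1; rewrite ?N1 // scale1r umx_rho -[RHS]scale1r.
apply/matrixP; do 2!apply: forall_I3; rewrite !mxE /= /eisp /= ?eis0 ?eis1 -?tauE; ring.
Qed.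

Lemma repm_aX j : repm (xa ^+ j)%g (Dmx (tau ^+ j)).
Proof.
elim: j => [|j IH]; first by rewrite expr0 Dmx1; exact: repm1.
by rewrite expgS exprS -DmxM; exact: repmM repm_a IH.
Qed.

Let om := tau - 1.

Lemma tau2E : tau ^+ 2 = om. Proof. by rewrite expr2 tau2. Qed.

(** The rotation part is that of a^2, so p a^-2 is a pure translation; this explains the form of
    [xt0]. *)
Lemma repm_p : repm xp (Tmx om 1 *m Dmx (tau ^+ 2)).
Proof.
apply/repm_prjP; exists 1; rewrite ?N1 // scale1r umx_rho tau2E /om.
have -> : lword (val wp) = [:: [:: (1, 0); (1, -1); (-1, 1)];
   [:: (0, 0); (-1, 1); (1, 0)]; [:: (0, 0); (0, 0); (1, 0)]] by vm_compute.
apply/matrixP; do 2!apply: forall_I3; rewrite [RHS]mulmx3E !mxE /= /eisp /= /eis ?rmorph1 /=;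
  have h := tau2 C; ring: h.
Qed.

Lemma repm_e : repm xe Emx.
Proof.
apply/repm_prjP; exists tau; rewrite ?N_tau // umx_rho.
have -> : lword (val we) = [:: [:: (0, 0); (0, 0); (0, -1)];
   [:: (0, 0); (0, 1); (0, 0)]; [:: (0, -1); (0, 0); (0, 0)]] by vm_compute.
apply/matrixP; do 2!apply: forall_I3; rewrite !mxE /= /eisp /= /eis; ring.
Qed.
End Representatives.

(** * The cusp stabiliser and heights *)

Section CuspStabiliser.
Variable R : realType.
Local Notation C := R[i].
Local Notation tau := (tau C).
Local Notation N := (@N R).
Local Notation O3 := (@O3 C).
Implicit Types (x y g : Gpres) (m n k : int) (u w z l : C).

(* [xt0] and [xt1] are translations over 1 and tau; [xvt] generates the vertical ones. *)
Definition xt0 := (xp * xa^-1 * xa^-1)%g.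
Definition xt1 := (xa * xt0 * xa^-1)%g.
Definition xvt := (xp * xp * xp)%g.
Definition trans := in_tr xt0 xt1 xvt.
Definition par := in_par xa xt0 xt1 xvt.

Lemma transM x y : trans x -> trans y -> trans (x * y)%g.
Proof. exact: (in_trM erefl erefl erefl xa6 xapa). Qed.
Lemma transV x : trans x -> trans x^-1%g.
Proof. exact: (in_trV erefl erefl erefl xa6 xapa). Qed.
Lemma parM x y : par x -> par y -> par (x * y)%g.
Proof. exact: (in_parM erefl erefl erefl xa6 xapa). Qed.
Lemma parV x : par x -> par x^-1%g.
Proof. exact: (in_parV erefl erefl erefl xa6 xapa). Qed.
Lemma par_aX j : par (xa ^+ j)%g. Proof. exact: in_par_aX. Qed.
Lemma par_p : par xp. Proof. exact: (in_par_p _ _ erefl). Qed.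
Lemma xaXV j : (xa ^- j = xa ^+ (5 * j))%g. Proof. exact: (aXV xa6). Qed.

Definition lat x w1 w2 :=
  [/\ null w1 w2, w1 \in O3, w2 \in O3 & repm x (Tmx w1 w2)].

Lemma lat1 : lat 1%g 0 0.
Proof. by split; rewrite ?rpred0 // ?Tmx00; [rewrite /null rmorph0; ring | exact: repm1]. Qed.

Lemma latM x y u1 u2 w1 w2 : lat x u1 u2 -> lat y w1 w2 ->
  lat (x * y)%g (u1 + w1 - u2^* * w2) (u2 + w2).
Proof.
move=> [n1 a1 b1 r1] [n2 a2 b2 r2]; split.
- rewrite /null !rmorphD rmorphN rmorphM /= conjCK.
  rewrite -[RHS]addr0 -{1}n1 -n2 /null; ring.
- by rewrite rpredB ?rpredD // rpredM // conj_O3.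
- by rewrite rpredD.
- by rewrite -TmxM; exact: repmM.
Qed.

Lemma TDmxM u1 u2 a w1 w2 b : N a = 1 ->
  Tmx u1 u2 *m Dmx a *m (Tmx w1 w2 *m Dmx b) =
  Tmx (u1 + w1 - u2^* * (a * w2)) (u2 + a * w2) *m Dmx (a * b).
Proof.
by move=> ha; rewrite -mulmxA (mulmxA (Dmx a)) DTmx // -mulmxA DmxM mulmxA TmxM.
Qed.

Lemma latV x w1 w2 : lat x w1 w2 -> lat x^-1%g w1^* (- w2).
Proof.
move=> [n1 a1 b1 r1]; split; [exact: nullN | exact: conj_O3 | by rewrite rpredN |].
by apply: (repmV r1); exact: TmxV.
Qed.

Lemma repm_aV : repm xa^-1%g (Dmx (tau ^+ 5)).
Proof. by have := repm_aX R 5; rewrite -(xaXV 1). Qed.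

Lemma om_O3 : tau - 1 \in O3. Proof. by rewrite rpredB ?rpred1 ?tau_O3. Qed.

Lemma null_om w : N w = 1 -> null (tau - 1) w.
Proof.
move=> /N_mul_conj h; rewrite /null h rmorphB rmorph1 /= conj_tau; ring.
Qed.

Lemma lat_t0 : lat xt0 (tau - 1) 1.
Proof.
split; rewrite ?om_O3 ?rpred1 //; first by apply: null_om; rewrite N1.
have := repmM (repmM (repm_p R) repm_aV) repm_aV.
rewrite -!mulmxA !DmxM -!exprD.
by rewrite (exprM tau 6 2 : tau ^+ (2 + (5 + 5)) = _) tau6 expr1n Dmx1 mulmx1.
Qed.

Lemma lat_t1 : lat xt1 (tau - 1) tau.
Proof.
split; rewrite ?om_O3 ?tau_O3 //; first by apply: null_om; rewrite N_tau.
have [_ _ _ h0] := lat_t0; have := repmM (repmM (repm_a R) h0) repm_aV.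
rewrite DTmx ?N_tau // mulr1 -mulmxA DmxM -exprS tau6 Dmx1 mulmx1.
by [].
Qed.

Lemma lat_vt : lat xvt (2 * tau - 1) 0.
Proof.
have h := tau2 C; split; rewrite ?rpred0 //.
- by rewrite /null rmorphB rmorphM rmorph1 rmorph_nat /= conj_tau; ring.
- by rewrite rpredB ?rpred1 // rpredM ?rpred_nat // tau_O3.
have hp := repm_p R; have hpp := repmM (repmM hp hp) hp.
suff -> : Tmx (2 * tau - 1) 0 = Tmx (tau - 1) 1 *m Dmx (tau ^+ 2) *m
  (Tmx (tau - 1) 1 *m Dmx (tau ^+ 2)) *m (Tmx (tau - 1) 1 *m Dmx (tau ^+ 2)) by [].
rewrite (TDmxM _ _ _ _ _ (Ntau R 2)) -exprD (TDmxM _ _ _ _ _ (Ntau R (2 + 2))) -exprD.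
rewrite (tau6 R : tau ^+ (2 + 2 + 2) = 1) Dmx1 mulmx1; congr Tmx.
  by rewrite rmorphD rmorphM rmorphXn rmorph1 /= conj_tau; ring: h.
by ring: h.
Qed.

Lemma lat_zexp x u1 u2 m : lat x u1 u2 -> exists w1, lat (zexp x m) w1 (m%:~R * u2).
Proof.
move=> hx; elim/int_step: m => [|m [w1 h]|m [w1 h]].
- by exists 0; rewrite mul0r; exact: lat1.
- by rewrite zexpS rmorphD /= mulrDl mul1r; exists (w1 + u1 - (m%:~R * u2)^* * u2); exact: latM.
- rewrite zexpB1 rmorphB /= mulrBl mul1r.
  by exists (w1 + u1^* - (m%:~R * u2)^* * - u2); apply: latM => //; exact: latV.
Qed.

Lemma lat_zexp_vt k : lat (zexp xvt k) (k%:~R * (2 * tau - 1)) 0.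
Proof.
have hv := lat_vt.
have hq : (2 * tau - 1)^* = - (2 * tau - 1).
  by rewrite rmorphB rmorphM rmorph1 rmorph_nat /= conj_tau; ring.
move: (2 * tau - 1) hv hq => q hv hq.
elim/int_step: k => [|k h|k h].
- by rewrite mul0r; exact: lat1.
- have := latM h hv; rewrite -zexpS rmorph0 mul0r subr0 addr0.
  by rewrite rmorphD /= mulrDl mul1r.
- have := latM h (latV hv); rewrite -zexpB1 rmorph0 oppr0 mul0r subr0 addr0 hq.
  by rewrite rmorphB /= mulrBl mul1r.
Qed.

(** [w1] is chosen before k: its exact value never matters, only that k shifts it by multiples of 2
    tau - 1 = i sqrt 3. *)
Lemma lat_tr m n : exists w1, forall k,
  lat (tr xt0 xt1 xvt m n k) (w1 + k%:~R * (2 * tau - 1)) (eis R m n).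
Proof.
have [v1 h1] := lat_zexp m lat_t0; have [v2 h2] := lat_zexp n lat_t1.
exists (v1 + v2 - (m%:~R * 1)^* * (n%:~R * tau)) => k.
have := latM (latM h1 h2) (lat_zexp_vt k).
by rewrite mulr0 subr0 addr0 mulr1.
Qed.

Lemma trans_lat x : trans x -> exists w1 w2, lat x w1 w2.
Proof.
move=> [m [n [k ->]]]; have [w1 h] := lat_tr m n.
by exists (w1 + k%:~R * (2 * tau - 1)), (eis R m n).
Qed.

Lemma Tmx_inj l u1 u2 w1 w2 a b :
  Tmx u1 u2 *m Dmx a = l *: (Tmx w1 w2 *m Dmx b) -> [/\ l = 1, u1 = w1 & u2 = w2].
Proof.
move=> /matrixP h.
have h1 := h i1 i2; rewrite [RHS]mxE !mulmx3E !mxE /= in h1.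
have h2 := h i0 i2; rewrite [RHS]mxE !mulmx3E !mxE /= in h2.
have h3 := h i2 i2; rewrite [RHS]mxE !mulmx3E !mxE /= in h3.
rewrite !(mul0r, mulr0, mul1r, mulr1, add0r, addr0) in h1 h2 h3.
by split; rewrite ?h1 ?h2 -?h3 ?mul1r.
Qed.

Lemma trans_faithful x : trans x -> repm x (Tmx (0 : C) 0) -> x = 1%g.
Proof.
move=> [m [n [k ->]]] h; have [w1 hw] := lat_tr m n.
have [_ _ _ h'] := hw k; have [l hl hT] := repm_uniq h' h.
have := @Tmx_inj l (w1 + k%:~R * (2 * tau - 1)) (eis R m n) 0 0 1 1.
rewrite !Dmx1 !mulmx1 => /(_ hT) [_ h1 h2].
have [m0 n0] : m = 0 /\ n = 0 by apply: (@eis_inj R); rewrite h2 eis0.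
subst m n; have [_ _ _ h3] := lat_zexp_vt k.
have trk : tr xt0 xt1 xvt 0 0 k = zexp xvt k by rewrite /tr /= !mul1g.
rewrite trk in h h' *.
have [l' _ hT'] := repm_uniq h3 h.
have := @Tmx_inj l' (k%:~R * (2 * tau - 1)) 0 0 0 1 1.
rewrite !Dmx1 !mulmx1 => /(_ hT') [_ h4 _].
have := congr1 (@cim R) h4; rewrite !coordE => h5.
have k0 : k%:~R = 0 :> R by lra.
by move/eqP: k0; rewrite intr_eq0 => /eqP ->.
Qed.

Lemma par_lat g : par g -> exists x w1 w2 j,
  [/\ trans x, lat x w1 w2, g = (x * xa ^+ j)%g & repm g (Tmx w1 w2 *m Dmx (tau ^+ j))].
Proof.
move=> [x [j [hx ->]]]; have [w1 [w2 h]] := trans_lat hx.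
exists x, w1, w2, j; split=> //; case: h => _ _ _ h.
by apply: repmM => //; exact: repm_aX.
Qed.

(** The quotient of the two translations has the identity matrix, hence is trivial by
    [trans_faithful]. This is how equalities in the presented group are read off from matrices. *)
Lemma par_same_cusp g g' w1 w2 a b : par g -> par g' ->
  repm g (Tmx w1 w2 *m Dmx a) -> repm g' (Tmx w1 w2 *m Dmx b) ->
  exists j, g' = (g * xa ^+ j)%g.
Proof.
move=> /par_lat[x [u1 [u2 [i [tx [nx _ _ lx] gE rg]]]]].
move=> /par_lat[y [v1 [v2 [j [ty [ny _ _ ly] gE' rg']]]]] hg hg'.
have [l _ hl] := repm_uniq rg hg; have [l' _ hl'] := repm_uniq rg' hg'.
have [_ e1 e2] := Tmx_inj hl; have [_ e3 e4] := Tmx_inj hl'.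
rewrite e1 e2 in lx nx; rewrite e3 e4 in ly.
have xy : (x^-1 * y = 1)%g.
  apply: trans_faithful; first by apply: transM => //; exact: transV.
  have := repmM (repmV lx (TmxV nx)) ly.
  rewrite TmxM addNr rmorphN /= mulNr opprK -[w1^* + w1 + _]addrA.
  by rewrite (_ : w1^* + (w1 + w2^* * w2) = 0) // -nx; ring.
have {}xy : y = x by rewrite -[RHS]mulg1 -xy mulVKg.
exists (5 * i + j)%N; rewrite gE' gE xy expgnDr -xaXV.
by rewrite mulgA mulgK.
Qed.

Lemma trans_exists w1 w2 : null w1 w2 -> w1 \in O3 -> w2 \in O3 ->
  exists2 x, trans x & repm x (Tmx w1 w2).
Proof.
move=> hn h1 /O3_eis[m [n hw2]]; have [v1 hv] := lat_tr m n.
have [n0 o0 _ _] := hv 0; rewrite mul0r addr0 in n0 o0.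
have : w1 - v1 \in O3 by rewrite rpredB.
move=> /O3_eis[a [b hab]].
(* Both [w1] and [v1] have real part -|w2|^2 / 2, so their difference is a purely imaginary
   Eisenstein integer, a multiple of 2 tau - 1. *)
have hre : 2 * a + b = 0.
  have e1 := congr1 (@cre R) hn; have e2 := congr1 (@cre R) n0; have e3 := congr1 (@cre R) hab.
  rewrite hw2 !coordE in e1; rewrite !coordE in e2; rewrite /eis !coordE in e3.
  apply/eqP; rewrite -(eqr_int R) rmorphD rmorphM /=; apply/eqP; lra.
exists (tr xt0 xt1 xvt m n (- a)); first by exists m, n, (- a).
have [_ _ _] := hv (- a); rewrite hw2; congr (repm _ (Tmx _ _)).
have -> : w1 = eis R a b + v1 by rewrite -hab subrK.
have -> : b = - (2 * a) by lia.
by rewrite /eis !rmorphN /= rmorphM /=; ring.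
Qed.
End CuspStabiliser.

Section Heights.
Variable R : realType.
Local Notation C := R[i].
Local Notation tau := (tau C).
Local Notation N := (@N R).
Local Notation O3 := (@O3 C).
Implicit Types (x y g : Gpres) (m n : int) (k : nat) (u w z l c d e : C).

(* Truncation is exact on Eisenstein integers. *)
Definition hn z : nat := Num.truncn (N z).
Lemma hnE z : z \in O3 -> (hn z)%:R = N z.
Proof.
move=> /O3_eis[m [n ->]]; rewrite /hn N_eis.
have : 0 <= m ^+ 2 + m * n + n ^+ 2 by nia.
by case: (_ + _) => // q _; rewrite [_%:~R]/(q%:R) natrK.
Qed.

Definition ht x : nat := hn (umx (rho R (repr x)) i2 i0).

Lemma rho_O3 (y : freeg 'I_2) i j : umx (rho R y) i j \in O3.
Proof. by rewrite umx_rho mxE; apply/O3_eis; do 2!eexists. Qed.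

Lemma htE x A : repm x A -> (ht x)%:R = N (A i2 i0).
Proof.
move=> [l hl h]; rewrite hnE ?rho_O3 // h mxE NM hl mul1r.
by [].
Qed.

Lemma row_null (A : UJ C) : umx A i2 i2 * (umx A i2 i0)^* + umx A i2 i1 * (umx A i2 i1)^* +
  umx A i2 i0 * (umx A i2 i2)^* = 0.
Proof.
have : umx A *m umx A^-1%g = 1%:M by rewrite -umxM mulgV.
rewrite umxV JmxE => /matrixP /(_ i2 i0).
have [r0 r1 r2] : [/\ rev_ord i0 = i2, rev_ord i1 = i1 & rev_ord i2 = i0].
  by split; exact: val_inj.
by rewrite mulmx3E !mxE /= !r0 !r1 !r2 => h; rewrite -[RHS]h; ring.
Qed.

Lemma row_neq0 (A : UJ C) : umx A i2 i0 = 0 -> umx A i2 i1 = 0 -> umx A i2 i2 <> 0.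
Proof.
move=> h0 h1 h2.
have : umx A *m umx A^-1%g = 1%:M by rewrite -umxM mulgV.
move=> /matrixP /(_ i2 i2); rewrite mulmx3E h0 h1 h2 !mul0r !add0r mxE /= => /eqP.
by rewrite eq_sym oner_eq0.
Qed.

Lemma mul_conj0 d : d * d^* = 0 -> d = 0.
Proof.
move=> /eqP; rewrite mulf_eq0 => /orP[/eqP //|/eqP h].
by rewrite -[d]conjCK h rmorph0.
Qed.

Lemma TD_col0 w1 w2 u (A : 'M[C]_3) : (A *m (Tmx w1 w2 *m Dmx u)) i2 i0 = A i2 i0.
Proof. by rewrite !mulmx3E !mxE /=; ring. Qed.

Lemma TD_col2 w1 w2 u (A : 'M[C]_3) : (A *m (Tmx w1 w2 *m Dmx u)) i2 i2 =
  A i2 i0 * w1 + A i2 i1 * w2 + A i2 i2.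
Proof. by rewrite !mulmx3E !mxE /=; ring. Qed.

Lemma E_col0 (A : 'M[C]_3) : (A *m Emx R) i2 i0 = - A i2 i2.
Proof. by rewrite mulmx3E !mxE /=; ring. Qed.

Lemma htE_e g A : repm g A -> (ht (g * xe)%g)%:R = N (A i2 i2).
Proof. by move=> h; rewrite (htE (repmM h (repm_e R))) E_col0 NN. Qed.

Lemma ht_par g x : par x -> ht (g * x)%g = ht g.
Proof.
move=> /(par_lat R)[y [w1 [w2 [j [_ _ _ hx]]]]].
have hg := repm_repr R g; apply/eqP; rewrite -(eqr_nat R).
by rewrite (htE (repmM hg hx)) TD_col0 -(htE hg).
Qed.

Lemma ht0 g : par g -> ht g = 0%N.
Proof.
move=> hg; rewrite -[g]mul1g ht_par //; apply/eqP; rewrite -(eqr_nat R) (htE (repm1 R)).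
by rewrite mxE /= N0.
Qed.

Lemma ht_e g : ht g = 0%N -> (0 < ht (g * xe)%g)%N.
Proof.
move=> h; have hg := repm_repr R g; rewrite -(ltr_nat R) (htE_e hg) N_gt0.
have : N (umx (rho R (repr g)) i2 i0) = 0 by rewrite -(htE hg) h.
move=> /eqP; rewrite N_eq0 => /eqP h0; apply/eqP => h2.
have := row_null (rho R (repr g)); rewrite h0 rmorph0 mulr0 mul0r add0r addr0.
by move=> /mul_conj0 h1; exact: (row_neq0 h0 h1 h2).
Qed.

Lemma ht_xe g x A w1 w2 u : repm g A -> repm x (Tmx w1 w2 *m Dmx u) ->
  (ht (g * x * xe)%g)%:R = N (A i2 i0 * w1 + A i2 i1 * w2 + A i2 i2).
Proof. by move=> hg hx; rewrite (htE_e (repmM hg hx)) TD_col2. Qed.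

Definition om (b : bool) : C := if b then tau - 1 else - tau.

Lemma om_conj b : (om b)^* = om (~~ b).
Proof. by case: b; rewrite /om /= ?rmorphN ?rmorphB ?rmorph1 /= conj_tau; ring. Qed.
Lemma N_om b : N (om b) = 1.
Proof.
case: b; rewrite /om /= ?NN ?N_tau //.
by rewrite /N /nrm !coordE; lra.
Qed.
Lemma cre_om b : cre (om b) = - (1 / 2). Proof. by case: b; rewrite /om !coordE; lra. Qed.
Lemma cim_om b : cim (om b) = half R b.
Proof. by case: b; rewrite /om !coordE /half; lra. Qed.

Definition xnbr (k : nat) (b : bool) := (xa ^+ k * (if b then xp else xp^-1))%g.

(** The inverse of p translates over tau instead of 1, whence the exponent shift when [b] is false.
    The twelve neighbours are those with [w1] a primitive cube root of unity and [w2] a unit. *)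
Lemma repm_xnbr k b : exists2 u, N u = 1 &
  repm (xnbr k b) (Tmx (om b) (tau ^+ (k + ~~ b)) *m Dmx u).
Proof.
have hp := repm_p R; case: b => /=; rewrite /xnbr.
  exists (tau ^+ k * tau ^+ 2); first by rewrite NM !Ntau mulr1.
  have := repmM (repm_aX R k) hp.
  by rewrite mulmxA DTmx ?Ntau // -mulmxA DmxM mulr1 addn0.
have hpV : repm xp^-1%g (Tmx (- tau) tau *m Dmx (tau ^+ 4)).
  apply: (repmV hp); rewrite TDmxM ?Ntau // -exprD tau6 Dmx1 mulmx1 -Tmx00.
  by have h := tau2 C; congr Tmx; rewrite ?rmorph1; ring: h.
exists (tau ^+ k * tau ^+ 4); first by rewrite NM !Ntau mulr1.
have := repmM (repm_aX R k) hpV.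
by rewrite mulmxA DTmx ?Ntau // -mulmxA DmxM -exprSr -[(k + _)%N]/(k + 1)%N addn1.
Qed.
End Heights.

(** * Local minima *)

Section RowGeometry.
Variable R : realType.
Local Notation C := R[i].
Local Notation tau := (tau C).
Local Notation N := (@N R).
Local Notation O3 := (@O3 C).
Local Notation om := (@om R).
Implicit Types (m n : int) (k : nat) (u w z l c d e : C).

Lemma coord_tauX z k :
  (cre (z * tau ^+ k), cim (z * tau ^+ k)) = iter k (@rot6 R) (cre z, cim z).
Proof.
elim: k => [|k IH]; first by rewrite expr0 mulr1.
rewrite iterS -IH exprSr mulrA; move: (z * _) => t; rewrite /rot6 /= !coordE; congr pair; lra.
Qed.

Section Row.
Variables c d e : C.
Hypothesis c0 : c != 0.
Hypothesis row0 : e * c^* + d * d^* + c * e^* = 0.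

Variables dl ep : C.
Hypotheses (dlE : dl = d / c) (epE : ep = e / c).

Lemma cre_ep : cre ep = - N dl / 2.
Proof.
have h : ep + ep^* + dl * dl^* = 0.
  have c1 : c^* != 0 by rewrite conjC_eq0.
  rewrite epE dlE !rmorphM !fmorphV /=; apply: (mulIf c0); apply: (mulIf c1).
  rewrite !mul0r -[RHS]row0; field.
  by rewrite c0 c1.
by have := congr1 (@cre R) h; rewrite !coordE /N /nrm; lra.
Qed.

Lemma N_row z w : N (c * w + d * z + e) = N c * N (w + dl * z + ep).
Proof. by rewrite -NM dlE epE; congr (N _); field. Qed.

Lemma N_e : N e = N c * N ep. Proof. by rewrite -NM epE mulrC divfK. Qed.

Let Nc0 : 0 < N c. Proof. by rewrite N_gt0. Qed.

Lemma row_local_min : N e <= N c ->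
  (forall k b, N e <= N (c * om b + d * tau ^+ k + e)) -> 16 * N e < 7 * N c.
Proof.
rewrite N_e -{2}[N c]mulr1 ler_pM2l // => h1 hF.
suff h : N ep < 7 / 16 by have := Nc0; nra.
rewrite {1}/N cre_ep; apply: local_min_bound; rewrite -/(N dl) -cre_ep -/(N ep) // => k b.
have := hF k b; rewrite N_row ler_pM2l //; congr (_ <= _); rewrite -coord_tauX /N /=.
by congr nrm; rewrite !coordE ?cre_om ?cim_om; lra.
Qed.

Hypothesis e_small : 16 * N e < 7 * N c.

Let ep_small : N ep < 7 / 16.
Proof. by move: e_small; rewrite N_e; have := Nc0; nra. Qed.

Lemma opposite_link k : 16 * N (c * (-2) + d * (2 * tau ^+ k) + e) < 7 * N c ->
  exists b, N (c * om b + d * tau ^+ k + e) < N c.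
Proof.
rewrite N_row => h.
have {}h : N (- 2 + dl * (2 * tau ^+ k) + ep) < 7 / 16 by have := Nc0; nra.
have [z zE] : exists z, dl * tau ^+ k = z by eexists.
have hz : N dl = N z by rewrite -zE NM Ntau mulr1.
have hep : cre ep = - N z / 2 by rewrite cre_ep hz.
have [b hb] : exists b, nrm (- N z / 2 + cre z - 1 / 2) (cim ep + cim z + half R b) < 1.
  apply: opposite_common_neighbour; rewrite -/(N z) -hep //.
  apply: le_lt_trans h; rewrite (mulrCA dl) zE /N le_eqVlt; apply/orP; left; apply/eqP.
  by congr nrm; rewrite !coordE; lra.
exists b; rewrite N_row -{2}[N c]mulr1 ltr_pM2l // zE.
apply: le_lt_trans hb; rewrite /N -hep le_eqVlt; apply/orP; left; apply/eqP.
by congr nrm; rewrite !coordE ?cre_om ?cim_om; lra.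
Qed.

Lemma sqrt3_link k : 16 * N (c * (tau - 2) + d * ((1 + tau) * tau ^+ k) + e) < 7 * N c ->
  N (c * om true + d * tau ^+ k + e) < N c.
Proof.
rewrite N_row => h.
have {}h : N (tau - 2 + dl * ((1 + tau) * tau ^+ k) + ep) < 7 / 16 by have := Nc0; nra.
have [z zE] : exists z, dl * tau ^+ k = z by eexists.
have hep : cre ep = - N z / 2 by rewrite cre_ep -zE NM Ntau mulr1.
have hb : nrm (- N z / 2 + cre z - 1 / 2) (cim ep + cim z + 1 / 2) < 1.
  apply: sqrt3_common_neighbour; rewrite -/(N z) -hep //.
  apply: le_lt_trans h; rewrite (mulrCA dl) zE /N le_eqVlt; apply/orP; left; apply/eqP.
  by congr nrm; rewrite !coordE; lra.
rewrite N_row -{2}[N c]mulr1 ltr_pM2l // zE.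
apply: le_lt_trans hb; rewrite /N -hep le_eqVlt; apply/orP; left; apply/eqP.
by congr nrm; rewrite !coordE ?cre_om ?cim_om /half; lra.
Qed.

(** Complex conjugation reduces this to [sqrt3_common_neighbour], applied to the conjugate of (d/c)
    tau^(k+1). *)
Lemma sqrt3_link' k : 16 * N (c * (- 1 - tau) + d * ((1 + tau) * tau ^+ k) + e) < 7 * N c ->
  N (c * om false + d * tau ^+ k.+1 + e) < N c.
Proof.
rewrite N_row => h.
have {}h : N (- 1 - tau + dl * ((1 + tau) * tau ^+ k) + ep) < 7 / 16 by have := Nc0; nra.
have [z zE] : exists z, dl * tau ^+ k = z by eexists.
have hep : cre ep = - N z / 2 by rewrite cre_ep -zE NM Ntau mulr1.
have nE (s t : R) : nrm s (- t) = nrm s t by rewrite /nrm sqrrN.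
have [y yE] : exists y, (z * tau)^* = y by eexists.
have hy : N z = N y by rewrite -yE N_conj NM N_tau mulr1.
have hb : nrm (- N y / 2 + cre y - 1 / 2) (- cim ep + cim y + 1 / 2) < 1.
  apply: sqrt3_common_neighbour; rewrite -/(N y) -hy -hep ?nE //.
  apply: le_lt_trans h; rewrite (mulrCA dl) zE /N -[leLHS]nE le_eqVlt; apply/orP; left; apply/eqP.
  by congr nrm; rewrite -yE !coordE; lra.
rewrite N_row -{2}[N c]mulr1 ltr_pM2l // exprSr (mulrA dl) zE.
apply: le_lt_trans hb; rewrite -hy -hep /N -[leRHS]nE le_eqVlt; apply/orP; left; apply/eqP.
by congr nrm; rewrite -yE !coordE ?cre_om ?cim_om /half; lra.
Qed.

(** Cauchy-Schwarz with weights 1/4 + 1/4 + 1/2 = 1, chosen so that two bounds 7/16 and the product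
    of the norms of d/c and its translate add up to exactly 7 in [lattice_bound]. *)
Lemma N_sum3 x y z : N (x + y + z) <= 4 * N x + 4 * N y + 2 * N z.
Proof.
rewrite /N /nrm !coordE.
have sq (s t r : R) : (s + t + r) ^+ 2 <= 4 * s ^+ 2 + 4 * t ^+ 2 + 2 * r ^+ 2.
  have h1 := sqr_ge0 (s - t); have h2 := sqr_ge0 (2 * s - r); have h3 := sqr_ge0 (2 * t - r).
  lra.
have := sq (cre x) (cre y) (cre z); have := sq (cim x) (cim y) (cim z); lra.
Qed.

(* Of the infinitely many parabolic elements only those with |w1|^2 < 7 can join two local minima. *)
Lemma lattice_bound w1 w2 : null w1 w2 -> 16 * N (c * w1 + d * w2 + e) < 7 * N c -> N w1 < 7.
Proof.
move=> hn; rewrite N_row => h.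
have {}h : N (w1 + dl * w2 + ep) < 7 / 16 by have := Nc0; nra.
have [ep' epE'] : exists z, w1 + dl * w2 + ep = z by eexists.
have [dl' dlE'] : exists z, dl - w2^* = z by eexists.
rewrite epE' in h.
have hep' : cre ep' = - N dl' / 2.
  have := cre_ep; have := congr1 (@cre R) hn.
  by rewrite -epE' -dlE' /N /nrm !coordE => *; lra.
have -> : w1 = ep' + ep^* + dl * dl'^*.
  apply: coord_inj; have := cre_ep; rewrite -epE' -dlE' /N /nrm !coordE => *; lra.
apply: le_lt_trans (N_sum3 _ _ _) _; rewrite NM !N_conj.
have a1 : (cre ep) ^+ 2 < 7 / 16 by move: ep_small; rewrite /N /nrm; have := sqr_ge0 (cim ep); lra.
have a2 : (cre ep') ^+ 2 < 7 / 16 by move: h; rewrite /N /nrm; have := sqr_ge0 (cim ep'); lra.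
have -> : N dl = - 2 * cre ep by rewrite cre_ep; lra.
have -> : N dl' = - 2 * cre ep' by rewrite hep'; lra.
have := ep_small; have := sqr_ge0 (cre ep - cre ep'); lra.
Qed.

(** Two points at distance sqrt 3 cannot both lie in a disc of radius sqrt 7 / 4 about the
    origin. *)
Lemma vertical_excluded w1 : cre w1 = 0 -> cim w1 = 1 \/ cim w1 = -1 ->
  ~ 16 * N (c * w1 + d * 0 + e) < 7 * N c.
Proof.
move=> h1 h2; rewrite N_row mulr0 addr0 => h.
have {}h : N (w1 + ep) < 7 / 16 by have := Nc0; nra.
move: h ep_small; rewrite /N /nrm !coordE h1.
have := sqr_ge0 (cre ep); rewrite add0r; case: h2 => ->; nra.
Qed.
End Row.
End RowGeometry.

(** * Short translations between local minima *)

Section Links.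
Variable R : realType.
Local Notation C := R[i].
Local Notation tau := (tau C).
Local Notation N := (@N R).
Local Notation O3 := (@O3 C).
Local Notation om := (@om R).
Implicit Types (x y g : Gpres) (m n : int) (k : nat) (u w z l c d e : C).

(** The prime over 3 is 1 + tau: as m = n modulo 3, it divides m + n tau, and the quotient has norm
    1. *)
Lemma N_eis3 m n : m ^+ 2 + m * n + n ^+ 2 = 3 -> exists k, eis R m n = (1 + tau) * tau ^+ k.
Proof.
move=> h; have [a [b [hm hn]]] : exists a b : int, m = a - b /\ n = a + 2 * b.
  have [q hq] : exists q, n - m = 3 * q.
    have e3 : (n - m) * (n - m) + 3 * (m * n) = 3 by rewrite -[RHS]h; ring.
    have [r [hr|[hr|hr]]] : exists r, n - m = 3 * r \/ n - m = 3 * r + 1 \/ n - m = 3 * r + 2.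
      by exists ((n - m) %/ 3)%Z; lia.
    - by exists r.
    - by exfalso; rewrite hr in e3; lia.
    - by exfalso; rewrite hr in e3; lia.
  by exists (m + q), q; lia.
have [|k _ hk] := @eis_units R a b; last first.
  exists k; rewrite -hk -eis1 [X in _ + X]tauE eisD eisM.
  by congr eis; lia.
by rewrite N_eis (_ : _ + _ = 1) //; subst m n; nia.
Qed.

(** The prime 2 is inert, so an even norm forces both coordinates to be even. *)
Lemma N_eis4 m n : m ^+ 2 + m * n + n ^+ 2 = 4 -> exists k, eis R m n = 2 * tau ^+ k.
Proof.
move=> h; have [a [b [hm hn]]] : exists a b : int, m = 2 * a /\ n = 2 * b.
  exists (m %/ 2)%Z, (n %/ 2)%Z.
  have [a ha] : exists a, m = 2 * a + (m %% 2)%Z by exists (m %/ 2)%Z; lia.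
  have [b hb] : exists b, n = 2 * b + (n %% 2)%Z by exists (n %/ 2)%Z; lia.
  have [h1|h1] : (m %% 2)%Z = 0 \/ (m %% 2)%Z = 1 by lia.
    have [h2|h2] : (n %% 2)%Z = 0 \/ (n %% 2)%Z = 1 by lia.
      by lia.
    by exfalso; rewrite h1 in ha; rewrite h2 in hb; subst m n; nia.
  have [h2|h2] : (n %% 2)%Z = 0 \/ (n %% 2)%Z = 1 by lia.
    by exfalso; rewrite h1 in ha; rewrite h2 in hb; subst m n; nia.
  by exfalso; rewrite h1 in ha; rewrite h2 in hb; subst m n; nia.
have [|k _ hk] := @eis_units R a b; last first.
  by exists k; rewrite -hk hm hn /eis !intrM; ring.
by rewrite N_eis (_ : _ + _ = 1) //; subst m n; nia.
Qed.

Lemma eis_om : eis R (-1) 1 = om true /\ eis R 0 (-1) = om false.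
Proof. by rewrite /eis /om; split; ring. Qed.

(** For w1 = X + Y tau the real part of [null] reads 2 X + Y = -|w2|^2, and |w1|^2 < 7 leaves
    finitely many pairs (X, Y). Since 2 is not a norm, |w2|^2 is 0, 1, 3 or 4. *)
Lemma null_small w1 w2 : w1 \in O3 -> w2 \in O3 -> null w1 w2 -> N w1 < 7 ->
  [\/ w2 = 0 /\ (w1 = 0 \/ (cre w1 = 0 /\ (cim w1 = 1 \/ cim w1 = -1))),
      exists k b, w1 = om b /\ w2 = tau ^+ k,
      exists k, w2 = (1 + tau) * tau ^+ k /\ (w1 = tau - 2 \/ w1 = - 1 - tau) |
      exists k, w2 = 2 * tau ^+ k /\ w1 = - 2].
Proof.
move=> /O3_eis[X [Y ->]] /O3_eis[m [n ->]] hn; rewrite N_eis -[7]/(7%:~R) ltr_int => h7.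
have {}hn : 2 * X + Y + (m ^+ 2 + m * n + n ^+ 2) = 0.
  have := congr1 (@cre R) hn; rewrite creD creD creM cre_conj cre_conj cim_conj cre0 => h.
  have hN := N_eis R m n; rewrite /N /nrm in hN.
  apply/eqP; rewrite -(eqr_int R) rmorphD /= -hN rmorphD rmorphM /=; apply/eqP.
  have c1 : cre (eis R X Y) = X%:~R + Y%:~R / 2 by rewrite /eis !coordE; lra.
  by move: h; rewrite c1; lra.
have M0 : 0 <= m ^+ 2 + m * n + n ^+ 2 by nia.
have hM : m ^+ 2 + m * n + n ^+ 2 = - (2 * X + Y) by lia.
have hb : (2 * X + Y) ^+ 2 + 3 * Y ^+ 2 <= 24 by nia.
have [hY1 hY2] : -2 <= Y /\ Y <= 2 by nia.
have [hZ1 hZ2] : -4 <= 2 * X + Y /\ 2 * X + Y <= 4 by nia.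
have [hX1 hX2] : -3 <= X /\ X <= 1 by lia.
have nX : (X = -3 \/ X = -2 \/ X = -1 \/ X = 0 \/ X = 1) by lia.
have nY : (Y = -2 \/ Y = -1 \/ Y = 0 \/ Y = 1 \/ Y = 2) by lia.
have [e1 e2] := eis_om.
have w0 : m ^+ 2 + m * n + n ^+ 2 = 0 -> eis R m n = 0.
  by move=> h; apply/eqP; rewrite -N_eq0 N_eis h.
have no2 : m ^+ 2 + m * n + n ^+ 2 <> 2.
  move=> h; have sq1 (t : int) : 3 * t ^+ 2 <= 8 -> -1 <= t /\ t <= 1 by clear; nia.
  have [h1 h2] : -1 <= m /\ m <= 1 by apply: sq1; have := sqr_ge0 (m + 2 * n); lia.
  have [h3 h4] : -1 <= n /\ n <= 1 by apply: sq1; have := sqr_ge0 (2 * m + n); lia.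
  have hm : m = -1 \/ m = 0 \/ m = 1 by lia.
  have hn' : n = -1 \/ n = 0 \/ n = 1 by lia.
  by case: hm => [hm|[hm|hm]]; case: hn' => [hn'|[hn'|hn']]; move: h; rewrite hm hn'.
have unit : m ^+ 2 + m * n + n ^+ 2 = 1 -> exists k, eis R m n = tau ^+ k.
  by move=> h; have [|j _ hj] := @eis_units R m n; [rewrite N_eis h | exists j].
have q0 : 2 * X + Y <= 0 by lia.
have XY : (X = -2 /\ Y = 0) \/ (X = -2 /\ Y = 1) \/ (X = -2 /\ Y = 2) \/ (X = -1 /\ Y = -1) \/
  (X = -1 /\ Y = 0) \/ (X = -1 /\ Y = 1) \/ (X = -1 /\ Y = 2) \/ (X = 0 /\ Y = -2) \/
  (X = 0 /\ Y = -1) \/ (X = 0 /\ Y = 0) \/ (X = 1 /\ Y = -2).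
  clear -nX nY hb q0; case: nX => [h|[h|[h|[h|h]]]]; case: nY => [h'|[h'|[h'|[h'|h']]]];
    rewrite h h' in hb q0; lia.
move: XY hM => [|[|[|[|[|[|[|[|[|[|]]]]]]]]]] [-> ->] hM.
- have [k hk] := N_eis4 hM; apply: Or44; exists k; split=> //; rewrite /eis; ring.
- have [k hk] := N_eis3 hM; apply: Or43; exists k; split=> //; left; rewrite /eis; ring.
- by case: no2.
- have [k hk] := N_eis3 hM; apply: Or43; exists k; split=> //; right; rewrite /eis; ring.
- by case: no2.
- by have [k hk] := unit hM; apply: Or42; exists k, true.
- apply: Or41; split; first exact: w0.
  by right; split; [rewrite /eis !coordE; lra | left; rewrite /eis !coordE; lra].
- by case: no2.
- by have [k hk] := unit hM; apply: Or42; exists k, false.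
- by apply: Or41; split; [exact: w0 | left; exact: eis0].
- apply: Or41; split; first exact: w0.
  by right; split; [rewrite /eis !coordE; lra | right; rewrite /eis !coordE; lra].
Qed.

Section RowLink.
Variables c d e : C.
Hypothesis c0 : c != 0.
Hypothesis row0 : e * c^* + d * d^* + c * e^* = 0.
Hypothesis e_small : 16 * N e < 7 * N c.

(** In the last alternative ([om b], [tau ^+ k]) is a neighbour y lying below g, and the quantity of
    norm 1 is the vertical coordinate [w1] of y^-1 x; this makes y^-1 x a neighbour as well, up to a
    power of a. *)
Lemma row_link w1 w2 : w1 \in O3 -> w2 \in O3 -> null w1 w2 ->
  16 * N (c * w1 + d * w2 + e) < 7 * N c ->
  [\/ w1 = 0 /\ w2 = 0, exists k b, w1 = om b /\ w2 = tau ^+ k |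
      exists k b, N (c * om b + d * tau ^+ k + e) < N c /\
        N ((om b)^* + w1 + (tau ^+ k)^* * w2) = 1].
Proof.
move=> o1 o2 hn h; have h7 := lattice_bound c0 row0 erefl erefl e_small hn h.
have tt k : (tau ^+ k)^* * tau ^+ k = 1 by rewrite mulrC; apply/N_mul_conj; exact: Ntau.
have t2 := tau2 C.
have [[h2 [h1|[h1 h1']]]|[k [b [-> ->]]]|[k [h2 [h1|h1]]]|[k [h2 h1]]] := null_small o1 o2 hn h7.
- by apply: Or31.
- by case: (vertical_excluded c0 (d := d) erefl erefl e_small h1 h1'); rewrite -h2.
- by apply: Or32; exists k, b.
- apply: Or33; exists k, true; split.
    by apply: (sqrt3_link c0 row0 erefl erefl e_small); rewrite -h1 -h2.
  rewrite om_conj h1 h2 mulrCA tt -(N_om R true); congr (N _); rewrite /= /om; ring.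
- apply: Or33; exists k.+1, false; split.
    by apply: (sqrt3_link' c0 row0 erefl erefl e_small); rewrite -h1 -h2.
  rewrite om_conj h1 h2 exprS rmorphM /= mulrCA -mulrA tt mulr1 conj_tau -(N_om R false).
  by congr (N _); rewrite /= /om; ring: t2.
- have hx : 16 * N (c * (-2) + d * (2 * tau ^+ k) + e) < 7 * N c by rewrite -h1 -h2.
  have [b hb] := opposite_link c0 row0 erefl erefl e_small hx.
  apply: Or33; exists k, b; split=> //.
  rewrite om_conj h1 h2 mulrCA tt -(N_om R (~~ b)); congr (N _); ring.
Qed.
End RowLink.
End Links.

(** * Faithfulness and generation *)

Section Faithful.
Variable R : realType.
Local Notation C := R[i].
Local Notation tau := (tau C).
Local Notation N := (@N R).
Local Notation O3 := (@O3 C).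
Local Notation om := (@om R).
Local Notation ht := (ht R).
Implicit Types (x y g : Gpres) (m n : int) (k : nat) (u w z l c d e : C).

Let A g := umx (rho R (repr g)).

Lemma xnbr_par k b : par (xnbr k b).
Proof. by apply: parM; [exact: par_aX | case: b; [|apply: parV]; exact: par_p]. Qed.

Definition lmin g := forall k b, (ht (g * xe)%g <= ht (g * xnbr k b * xe)%g)%N.

Lemma ht_xnbr_e g B k b : repm g B ->
  (ht (g * xnbr k b * xe)%g)%:R = N (B i2 i0 * om b + B i2 i1 * tau ^+ (k + ~~ b) + B i2 i2).
Proof. by move=> hg; have [u _ h] := repm_xnbr R k b; rewrite (ht_xe hg h). Qed.

(** Compensates the exponent shift of [repm_xnbr]; 5 stands for -1 modulo 6. *)
Lemma tau_shift k b : tau ^+ (k + (if b then 0 else 5) + ~~ b) = tau ^+ k.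
Proof. by case: b => /=; rewrite ?addn0 // -addnA exprD tau6 mulr1. Qed.

Lemma lmin_small g B : repm g B -> (0 < ht g)%N -> (ht (g * xe)%g <= ht g)%N -> lmin g ->
  16 * N (B i2 i2) < 7 * N (B i2 i0).
Proof.
move=> hg h0 h1 hl.
have c0 : B i2 i0 != 0 by rewrite -N_gt0 -(htE hg) ltr0n.
have [l hl1 hB] := repm_uniq hg (repm_repr R g).
have row0 : B i2 i2 * (B i2 i0)^* + B i2 i1 * (B i2 i1)^* + B i2 i0 * (B i2 i2)^* = 0.
  have := row_null (rho R (repr g)); rewrite hB !mxE !rmorphM /=.
  by move=> h; rewrite -[RHS](mulr0 (l * l^*)) -h; ring.
apply: (row_local_min c0 row0 erefl erefl).
  by rewrite -(htE_e hg) -(htE hg) ler_nat.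
move=> k b; rewrite -(htE_e hg) -(tau_shift k b) -(ht_xnbr_e _ _ hg) ler_nat.
exact: hl.
Qed.

Lemma xlocal_min_lt g : (0 < ht g)%N -> (ht (g * xe)%g <= ht g)%N -> lmin g ->
  (ht (g * xe)%g < ht g)%N.
Proof.
move=> h0 h1 hl; have hg := repm_repr R g.
rewrite -(ltr_nat R) (htE_e hg) (htE hg).
have := lmin_small hg h0 h1 hl.
by have := N_ge0 (A g i2 i2); rewrite /A; lra.
Qed.

Lemma xlocal_min_link g x : (0 < ht g)%N -> (ht (g * xe)%g <= ht g)%N -> lmin g ->
  par x -> (ht (g * x * xe)%g <= ht g)%N -> lmin (g * x)%g ->
  [\/ exists j, x = (xa ^+ j)%g, exists k b j, x = (xnbr k b * xa ^+ j)%g |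
      exists k b k' b' j, x = (xnbr k b * xnbr k' b' * xa ^+ j)%g /\
        (ht (g * xnbr k b * xe)%g < ht g)%N].
Proof.
move=> h0 h1 hl hx h2 hlx; have hg := repm_repr R g.
have [t [w1 [w2 [j [_ [hn o1 o2 _] _ rx]]]]] := par_lat R hx.
have hs := lmin_small hg h0 h1 hl.
have c0 : A g i2 i0 != 0 by rewrite -N_gt0 -(htE hg) ltr0n.
have hgx : ht (g * x)%g = ht g by exact: ht_par.
have := lmin_small (repmM hg rx); rewrite TD_col0 TD_col2 hgx => /(_ h0 h2 hlx) hs'.
have nbr_of k b y u : par y -> repm y (Tmx (om b) (tau ^+ k) *m Dmx u) ->
    exists k' j, y = (xnbr k' b * xa ^+ j)%g.
  move=> py ry; have [v _ rn] := repm_xnbr R (k + (if b then 0 else 5)) b.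
  rewrite tau_shift in rn; have [i ->] := par_same_cusp (xnbr_par _ _) py rn ry.
  by eexists; eexists.
have [[e1 e2]|[k [b [e1 e2]]]|[k [b [hlt hN]]]] := row_link c0 (row_null _) hs o1 o2 hn hs'.
- rewrite e1 e2 in rx; apply: Or31.
  have r1 : repm (1 : Gpres)%g (Tmx (0 : C) 0 *m Dmx 1) by rewrite Tmx00 Dmx1 mulmx1; exact: repm1.
  have [i ->] := par_same_cusp (par_aX 0) hx r1 rx; exists i.
  by rewrite mul1g.
- rewrite e1 e2 in rx; apply: Or32; have [k' [i ->]] := nbr_of _ _ _ _ hx rx.
  by exists k', b, i.
have [v hv rn] := repm_xnbr R (k + (if b then 0 else 5)) b; rewrite tau_shift in rn.
pose y := xnbr (k + (if b then 0 else 5)) b; have py : par y by exact: xnbr_par.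
have hyx : par (y^-1 * x)%g by apply: parM => //; exact: parV.
have [t' [v1 [v2 [i [_ [hn' o1' o2' _] _ rx']]]]] := par_lat R hyx.
apply: Or33; exists (k + (if b then 0 else 5))%N, b.
have hN1 : N v1 = 1.
  have := repmM rn rx'; rewrite -/y mulVKg TDmxM // => rx''.
  have [l _ hT] := repm_uniq rx rx''; have [_ e1 e2] := Tmx_inj hT.
  have tt : tau ^+ k * (tau ^+ k)^* = 1 by apply/N_mul_conj; exact: Ntau.
  rewrite -hN e1 e2 mulrDr [_^* * tau ^+ k]mulrC tt om_conj; congr (N _).
  by case: (b); rewrite /= /om; ring.
(* Among the short translations only the neighbours have |v1|^2 = 1; the others have 0, 3 or 4. *)
have [k1 [b1 [e1 e2]]] : exists k b, v1 = om b /\ v2 = tau ^+ k.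
  have N7 : N v1 < 7 by rewrite hN1; lra.
  have [|//| |] := null_small o1' o2' hn' N7.
  - move=> [_ [h|[h h']]]; exfalso; move: hN1; first by rewrite h N0; lra.
    by rewrite /N /nrm h; case: h' => ->; lra.
  - by move=> [k1 [_ [h|h]]]; exfalso; move: hN1; rewrite h /N /nrm !coordE; lra.
  - by move=> [k1 [_ h]]; exfalso; move: hN1; rewrite h /N /nrm !coordE; lra.
rewrite e1 e2 in rx'; have [k' [i' hy]] := nbr_of _ _ _ _ hyx rx'.
exists k', b1, i'; split; last first.
  by rewrite -(ltr_nat R) (ht_xnbr_e _ _ hg) tau_shift (htE hg).
by rewrite -mulgA -hy mulVKg.
Qed.

Notation good := (good par xe ht).

Lemma good_mul_par g x : par x -> good g -> good (g * x)%g.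
Proof. exact: (good_mulr parM parV (@ht_par R)). Qed.

Lemma good_mul_xe g : good g -> good (g * xe)%g.
Proof.
apply: (good_e parM parV par_aX par_p xe2 xea xpe3 (fun k b => erefl (xnbr k b))
  (@ht_par R) (@ht0 R) (@ht_e R) xlocal_min_lt xlocal_min_link).
Qed.

Lemma all_good g : good g.
Proof.
have pV := parV par_p; have pa := par_aX 1; rewrite expg1 in pa.
have xeV : (xe^-1 = xe)%g by rewrite -[LHS]mulg1 -xe2 mulKg.
elim/prj_ind: g => [|g hg|g hg|g hg|g hg].
- by apply: good_par; exact: (par_aX 0).
- exact: good_mul_par.
- by apply: good_mul_par => //; exact: parV.
- rewrite xb_eq !mulgA; do 3!(apply: good_mul_par; first by [| exact: parV]).
  by apply: good_mul_xe; apply: good_mul_par => //; exact: par_p.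
- rewrite xb_eq !invgM !invgK xeV !mulgA; apply: good_mul_par => //; apply: good_mul_xe.
  by do 3!(apply: good_mul_par; first by [exact: par_p | exact: pa]).
Qed.

Lemma ht_eq0_par g : ht g = 0%N -> par g.
Proof. exact: good_ht0 (all_good g). Qed.

(** The corner entry forces l = 1, and tau has order exactly six while a^6 = 1 is a relator. *)
Lemma Dmx_scalar j l : Dmx (tau ^+ j) = l%:M -> (xa ^+ j = 1)%g.
Proof.
move=> /matrixP h; have h0 := h i0 i0; have h1 := h i1 i1.
move: h0 h1; rewrite !mxE /= !mulr1n => <- h1.
move: h1; rewrite (divn_eq j 6) exprD expgnDr mulnC exprM expgnA tau6 xa6 expr1n expg1n mul1r mul1g.
have : (j %% 6 < 6)%N by rewrite ltn_pmod.
case: (j %% 6)%N => [|[|[|[|[|[|//]]]]]] // _ h1; exfalso;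
  have := congr1 (@cre R) h1; rewrite !exprS expr0 !coordE; lra.
Qed.

Lemma rho_faithful (y : freeg 'I_2) : rho R y \in @scalarUJ C -> prj y = 1%g.
Proof.
rewrite unfold_in => /is_scalar_mxP[l hl].
have hy := repm_prj R y; rewrite [umx _]hl in hy.
have py : par (prj y).
  by apply: ht_eq0_par; apply/eqP; rewrite -(eqr_nat R) (htE hy) mxE /= N0.
rewrite -[l%:M]scalemx1 in hy; have {}hy := repmZ (scalarUJ_N hl) hy.
have r1 : repm (1 : Gpres)%g (Tmx (0 : C) 0 *m Dmx 1) by rewrite Tmx00 Dmx1 mulmx1; exact: repm1.
have ry : repm (prj y) (Tmx (0 : C) 0 *m Dmx 1) by rewrite Tmx00 Dmx1 mulmx1.
have [j] := par_same_cusp (par_aX 0) py r1 ry; rewrite mul1g => hj.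
have := repm_aX R j; rewrite -hj => hj'; have [l' _] := repm_uniq hj' hy.
by rewrite scalemx1 hj => /Dmx_scalar.
Qed.
End Faithful.

(** * Surjectivity by the Euclidean algorithm *)

Section Generation.
Variable R : realType.
Local Notation C := R[i].
Local Notation tau := (tau C).
Local Notation N := (@N R).
Local Notation O3 := (@O3 C).
Implicit Types (x y g : Gpres) (m n : int) (k : nat) (u w z l c d e : C).

Lemma nearest_int (r : R) : exists k : int, - (1 / 2) <= r - k%:~R <= 1 / 2.
Proof.
exists (Num.floor (r + 1 / 2)); have /andP[] := floor_itv (r + 1 / 2).
rewrite intrD; lra.
Qed.

(** Rounding d/c to the conjugate of [w2] leaves |d/c - w2^*|^2 <= 1/4 + 3/16 = 7/16, and rounding
    vertically leaves an imaginary coordinate of at most 1/2. The ratio of heights is then at most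
    (7/32)^2 + 3/4 < 1. *)
Lemma null_shorten c d e : c != 0 -> e * c^* + d * d^* + c * e^* = 0 ->
  exists w1 w2, [/\ w1 \in O3, w2 \in O3, null w1 w2 & N (c * w1 + d * w2 + e) < N c].
Proof.
move=> c0 row0; have [dl dlE] : exists z, z = d / c by eexists.
have [ep epE] : exists z, z = e / c by eexists.
have hep := cre_ep c0 row0 dlE epE.
(* The imaginary coordinate of m + n tau is n/2, so doubling before rounding brings the error down
   to 1/4. *)
have [n' /andP[n1 n2]] := nearest_int (2 * cim dl).
have [m' /andP[m1 m2]] := nearest_int (cre dl - n'%:~R / 2).
pose n := - n'; pose m := m' + n'; pose M := m ^+ 2 + m * n + n ^+ 2.
pose w2 := eis R m n.
have w2c : w2^* = eis R m' n' by rewrite eis_conj; congr eis; rewrite /m /n; lia.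
have [k /andP[k1 k2]] := nearest_int (M%:~R / 2 - cim (dl * w2 + ep)).
(* These coordinates give the real part -M/2 required by [null] for every k, and k moves the
   imaginary coordinate by whole units. *)
pose w1 := eis R (- k) (2 * k - M).
have hM : N w2 = M%:~R by rewrite N_eis.
have hn : null w1 w2.
  have hw2 : cre (w2 * w2^*) = M%:~R by rewrite -hM /N /nrm creM cre_conj cim_conj; lra.
  have hw2' : cim (w2 * w2^*) = 0 by rewrite cimM cre_conj cim_conj; lra.
  have hw1 : cre w1 = - M%:~R / 2.
    by rewrite /w1 /eis !coordE rmorphN rmorphB rmorphM /=; lra.
  apply: coord_inj; first by rewrite cre0 2!creD cre_conj hw1 hw2; lra.
  by rewrite cim0 2!cimD cim_conj hw2'; lra.
exists w1, w2; split=> //; try by apply/O3_eis; do 2!eexists.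
rewrite (N_row c0 dlE epE) -[X in _ < X]mulr1 ltr_pM2l ?N_gt0 //.
have e1 : cre (w1 + dl * w2 + ep) = - N (dl - w2^*) / 2.
  have := congr1 (@cre R) hn; move: hep; clearbody w1 w2.
  by rewrite /N /nrm !coordE; lra.
have e2 : N (dl - w2^*) <= 7 / 16.
  rewrite /N /nrm w2c !creD !cimD !creN !cimN /eis !coordE.
  have q (t b : R) : - b <= t -> t <= b -> t ^+ 2 <= b ^+ 2 by clear; nra.
  have q1 := q (cre dl - (m'%:~R + n'%:~R / 2)) (1 / 2).
  have q2 := q (cim dl - n'%:~R / 2) (1 / 4).
  have {}q1 := q1 ltac:(lra) ltac:(lra); have {}q2 := q2 ltac:(lra) ltac:(lra).
  lra.
have e3 : cim (w1 + dl * w2 + ep) = k%:~R - (M%:~R / 2 - cim (dl * w2 + ep)).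
  rewrite -addrA cimD [in LHS]/w1 /eis; move: (cim (dl * w2 + ep)) => t.
  by rewrite !coordE !rmorphB rmorphM /=; lra.
rewrite /N /nrm e1 e3.
have e0 := N_ge0 (dl - w2^*).
move: (N _) e2 e0 (M%:~R / 2 - _) k1 k2 => t t1 t0 s s1 s2; clear -t1 t0 s1 s2.
nra.
Qed.

Definition integral (A : UJ C) := forall i j, umx A i j \in O3.

(** J-unitarity makes A upper triangular with unit corners. Divided by its corner entry, A is a
    Heisenberg translation times diag(1, u, 1) with u a power of tau, and both factors come from the
    presented group. *)
Lemma integral_cusp (A : UJ C) : integral A -> umx A i2 i0 = 0 ->
  exists y : freeg 'I_2, exists2 l, N l = 1 & umx A = l *: umx (rho R y).
Proof.
move=> hA c0.
have d0 : umx A i2 i1 = 0.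
  by have := row_null A; rewrite c0 rmorph0 mulr0 mul0r add0r addr0 => /mul_conj0.
have inv : umx A *m umx A^-1%g = 1%:M by rewrite -umxM mulgV.
have [r0 r1 r2] : [/\ rev_ord i0 = i2, rev_ord i1 = i1 & rev_ord i2 = i0].
  by split; exact: val_inj.
have ent i j : \sum_k umx A i k * (umx A (rev_ord j) (rev_ord k))^* = (i == j)%:R.
  have := congr1 (fun M : 'M[C]_3 => M i j) inv; rewrite umxV JmxE !mxE => <-.
  by apply: eq_bigr => k _; rewrite !mxE.
have h22 := ent i2 i2; have h10 := ent i1 i0; have h11 := ent i1 i1.
have h12 := ent i1 i2; have h02 := ent i0 i2.
move: h22 h10 h11 h12 h02; rewrite !sum3 /= !r0 !r1 !r2 c0 d0 rmorph0 !(mul0r, mulr0, add0r, addr0).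
move=> h22 h10 h11 h12 h02.
have l1 : N (umx A i0 i0) = 1.
  have := congr1 N h22; rewrite NM N_conj N1 -!hnE ?hA // => /eqP.
  by rewrite -natrM (eqr_nat R _ 1) muln_eq1 => /andP[_ /eqP ->].
have := l1 => /N_mul_conj hl.
have e22 : umx A i2 i2 = umx A i0 i0 by rewrite -[LHS]mulr1 -hl mulrCA h22 mulr1.
have a0 : umx A i1 i0 = 0.
  by rewrite e22 in h10; rewrite -[LHS]mulr1 -hl mulrCA h10 mulr0.
move: h11 h12; rewrite a0 rmorph0 !(mul0r, mulr0, add0r, addr0) => h11 h12.
have hO := hA i0 i2; have hO' := hA i1 i2; have hO1 := hA i1 i1; have hO0 := hA i0 i0.
have eA : umx A i0 i1 = - umx A i0 i0 * (umx A i1 i2)^* * umx A i1 i1.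
  have := congr1 (fun z => z^*) h12; rewrite /= rmorphD !rmorphM /= !conjCK rmorph0 => /eqP; rewrite addr_eq0 => /eqP h12'.
  by rewrite -[LHS]mulr1 -[1](h11 : _ = 1); ring: h12'.
pose w1 := (umx A i0 i0)^* * umx A i0 i2; pose w2 := (umx A i0 i0)^* * umx A i1 i2.
pose u := (umx A i0 i0)^* * umx A i1 i1.
have [j _ hu] : exists2 j, (j < 6)%N & u = tau ^+ j.
  have /O3_eis[m [n hmn]] : u \in O3 by rewrite rpredM // conj_O3.
  have hN : N u = 1 by rewrite NM N_conj l1 mul1r; apply/N_mul_conj.
  by rewrite hmn in hN *; exact: eis_units.
have hn : null w1 w2.
  move: h02; rewrite eA !rmorphM rmorphN /= !conjCK => h02.
  rewrite /null /w1 /w2 !rmorphM /= !conjCK -[RHS](h02 : _ = 0).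
  by have {}h11 : umx A i1 i1 * (umx A i1 i1)^* = 1 := h11; ring: hl h11.
have o1 : w1 \in O3 by rewrite rpredM // conj_O3.
have o2 : w2 \in O3 by rewrite rpredM // conj_O3.
have [x _ rx] := trans_exists hn o1 o2.
have rxa := repmM rx (repm_aX R j); have [l hl1 hE] := repm_uniq rxa (repm_repr R _).
exists (repr (x * xa ^+ j)%g), (umx A i0 i0 * l); first by rewrite NM l1 hl1 mulr1.
rewrite -scalerA -hE -hu; apply/matrixP; do 2!apply: forall_I3;
  rewrite [RHS]mxE mulmx3E !mxE /= ?c0 ?d0 ?a0 ?e22 ?eA /w1 /w2 /u ?rmorphM /= ?conjCK; ring: hl.
Qed.

Lemma integral_rho (A : UJ C) : integral A ->
  exists y : freeg 'I_2, exists2 l, N l = 1 & umx A = l *: umx (rho R y).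
Proof.
have [n] := ubnP (hn (umx A i2 i0)); elim: n A => // n IH A hA_lt hA.
have [c0|c0] := eqVneq (umx A i2 i0) 0; first exact: integral_cusp.
have [w1 [w2 [o1 o2 h0 hlt]]] := null_shorten c0 (row_null A).
have [x _ rx] := trans_exists h0 o1 o2.
have [l hl1 hE] := repm_uniq (repm_repr R _) (repmM rx (repm_e R)).
pose y := repr (x * xe)%g; pose B := (A * rho R y)%g.
have hB : integral B.
  by move=> i j; rewrite umxM mulmx3E !rpredD // rpredM // rho_O3.
have hB20 : N (umx B i2 i0) < N (umx A i2 i0).
  rewrite umxM hE -scalemxAr mxE NM hl1 mul1r mulmxA E_col0 NN.
  have := TD_col2 w1 w2 1 (umx A); rewrite Dmx1 mulmx1 => ->.
  exact: hlt.
have [|y' [l' hl' hy']] := IH B _ hB.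
  by rewrite -ltnS; apply: leq_trans hA_lt; rewrite ltnS -(ltr_nat R) !hnE.
exists (y' * y^-1)%g, l' => //.
by rewrite rhoM umxM scalemxAl -hy' -umxM rhoV /B mulgK.
Qed.
End Generation.

(** * The isomorphism with the Eisenstein-Picard group *)

Section Isomorphism.
Variable R : realType.
Local Notation C := R[i].
Local Notation O3 := (@O3 C).
Implicit Types (x y g : Gpres).

Lemma integral_GLO3 (A : UJ C) : integral A -> val A \in @GLO3 C.
Proof.
move=> hA; rewrite unfold_in; apply/andP; split; apply/mxOverP => i j; first exact: hA.
rewrite -[_ i j]/(umx A^-1%g i j) umxV JmxE !mxE; exact/conj_O3/hA.
Qed.

Lemma GLO3_integral (A : UJ C) : val A \in @GLO3 C -> integral A.
Proof. by rewrite unfold_in => /andP[/mxOverP hA _]. Qed.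

Lemma rho_integral (w : freeg 'I_2) : integral (rho R w).
Proof. by move=> i j; exact: rho_O3. Qed.

Definition rho_bar (g : Gpres) : Gamma3 C := exist _ (cosetg _ (rho R (repr g)))
  (asboolT (ex_intro _ (rho R (repr g)) (conj (integral_GLO3 (rho_integral (repr g))) erefl))).

(** The relators lie in [kerM], so the class does not depend on the representative picked by
    [repr]. *)
Lemma rho_bar_prj (w : freeg 'I_2) : val (rho_bar (prj w)) = cosetg _ (rho R w).
Proof.
apply/cosetgP.
have /cosetgP /normal_closureP /(_ (@kerM R)) h : prj (repr (prj w)) = prj w by exact: cosetgK.
by have := h (@kerM_rels R); rewrite unfold_in rhoM rhoV.
Qed.

Lemma rho_barM : {morph rho_bar : x y / (x * y)%g}.
Proof.
move=> x y; apply: val_inj; rewrite -[in LHS](cosetgK x) -[in LHS](cosetgK y) -!/(prj _) -prjM.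
by rewrite rho_bar_prj rhoM cosetgM.
Qed.

HB.instance Definition _ := isMultiplicative.Build Gpres (Gamma3 C) rho_bar rho_barM.

Lemma rho_bar_inj : injective rho_bar.
Proof.
move=> x y h; have /cosetgP := congr1 val h; rewrite -rhoV -rhoM => /rho_faithful.
by rewrite prjM prjV /prj !cosetgK => /(congr1 (fun z => x * z)%g); rewrite mulVKg mulg1 => ->.
Qed.

Lemma rho_bar_surj (v : Gamma3 C) : exists g, rho_bar g = v.
Proof.
have /asboolP[A [hA hv]] := valP v; have [w [l _ hw]] := integral_rho (GLO3_integral hA).
exists (prj w); apply: val_inj; rewrite rho_bar_prj hv.
apply/cosetgP; rewrite unfold_in; apply/is_scalar_mxP; exists l.
rewrite -[LHS]/(umx ((rho R w)^-1 * A)%g) umxM hw -scalemxAr -umxM mulVg.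
by rewrite umx1 scalemx1.
Qed.

Lemma rho_bar_bij : bijective rho_bar.
Proof.
pose f v := sval (cid (rho_bar_surj v)).
have fK : cancel f rho_bar by move=> v; rewrite /f; case: cid.
by exists f => // x; apply: rho_bar_inj; rewrite fK.
Qed.

Lemma rho_bar_gen (i : 'I_2) :
  rho_bar (prj (fgen i)) = tnth [tuple gamma_a C; gamma_b C] i.
Proof.
apply: val_inj; rewrite rho_bar_prj /rho free_lift_gen /genU.
by case: i => [[|[|]]] // hi; rewrite (tnth_nth (gamma_a C)).
Qed.

Lemma Gamma3_generated : generates [:: gamma_a C; gamma_b C].
Proof.
move=> H hH sub v; have [g <-] := rho_bar_surj v.
have H1 := hH.1; have HM := group_closedM hH; have HV := group_closedV hH.
have ea : rho_bar xa = gamma_a C by exact: (rho_bar_gen ord0).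
have eb : rho_bar xb = gamma_b C by exact: (rho_bar_gen ord_max).
have ha : rho_bar xa \in H by rewrite ea sub // inE eqxx.
have hb : rho_bar xb \in H by rewrite eb sub // !inE eqxx orbT.
have rho1 : rho_bar 1%g = 1%g by apply: (mulgI (rho_bar 1%g)); rewrite -rho_barM !mulg1.
have rhoV z : rho_bar z^-1%g = (rho_bar z)^-1%g.
  by apply: (mulgI (rho_bar z)); rewrite -rho_barM !mulgV.
elim/prj_ind: g => [|g IH|g IH|g IH|g IH].
- by rewrite rho1.
- by rewrite rho_barM; exact: HM.
- by rewrite rho_barM rhoV; apply: HM => //; exact: HV.
- by rewrite rho_barM; exact: HM.
- by rewrite rho_barM rhoV; apply: HM => //; exact: HV.
Qed.
End Isomorphism.

Theorem mainTheorem15 (R : realType) :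
  generates [:: gamma_a R[i]; gamma_b R[i]] /\
  let a := fgen (ord0 : 'I_2) in
  let b := fgen (ord_max : 'I_2) in
  (let e := b * a^-1 * b^-1 * a ^- 2 * b ^+ 2 * a ^+ 2 * b * a * b^-1 in
   let f := a * b ^- 2 * a^-1 in
   let g := b ^+ 2 * a^-1 * b ^+ 2 in
   let h := a^-1 * b ^+ 2 * a ^+ 2 * b * a * b^-1 in
   has_presentation (tnth [tuple gamma_a R[i]; gamma_b R[i]])
     [:: (a ^+ 6, 1); (b ^+ 4, 1); (e ^+ 2, 1); (f ^+ 2, 1); (g ^+ 6, 1);
         (h ^+ 3, 1); br 2 a e; br 4 f g; ((a * b) ^+ 3, 1)])%g.
Proof.
split; first exact: Gamma3_generated.
(* The list in the statement is convertible with [rels15]. *)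
exists (rho_bar R : {multiplicative presented rels15 -> Gamma3 R[i]}).
by split; [exact: rho_bar_bij | exact: rho_bar_gen].
Qed.
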